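(* Let $(X,P)$ be an irreducible, transient random walk on an at most countable set $X$ and let $\mu$ be a (signed) measure on $X$. Let $\widehat X$ be the Martin compactification, $\partial X$ the Martin boundary and $k_x$ ($x\in X$) the (extended) Martin kernels. (a) For all $x,y\in X$ we have $$\sup_{z\in\widehat X}k_x(y,z)=\max_{z\in X}k_x(y,z)=\frac1{F(x,y)},$$ and for all $x,y\in X$, $$\sup_{z\in X}k_x(\cdot,z)\in L^1(|\mu|)\iff\sup_{z\in X}k_y(\cdot,z)\in L^1(|\mu|).$$ (b) Let $o\in X$ and suppose $\sup_{z\in X}k_o(\cdot,z)\in L^1(|\mu|)$ (i.e. $1/F(o,\cdot)\in L^1(|\mu|)$). Consider the assertions: (i) $\mu$ has the weak mean value property with respect to $o$; (ii) $L(k_o(\cdot,\xi),\mu)(o)=0$ for almost every $\xi\in\partial X$ (with respect to the harmonic measures). Then (ii) $\Longrightarrow$ (i). In particular, if the Martin compactification is almost regular, then (i) $\Longleftrightarrow$ (ii).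
   Context: $X$ is an at most countable set and $P=(p(x,y))_{x,y\in X}$ is a Markov operator: $p(x,y)\ge 0$, $\sum_{y}p(x,y)=1$, $(Pf)(x)=\sum_y p(x,y)f(y)$ whenever $\sum_y p(x,y)|f(y)|<\infty$ for all $x$. $f:X\to\mathbb{R}$ is harmonic if $Pf=f$; $\mathcal H^\infty(X,P)$ is the set of bounded harmonic functions. $Z_n$ denotes the associated Markov chain, $\Pr_x$ its law started from $x$, and $F(x,y)=\Pr_x(\exists n\ge 0: Z_n=y)$ (so $F(x,x)=1$). A compactification of the discrete set $X$ is a compact Hausdorff space $\widehat X$ containing $X$ as an open, discrete, dense subset. For $o\in X$ the Martin kernel is $k_o(x,y)=F(x,y)/F(o,y)$, $x,y\in X$. The Martin compactification $\widehat X$ is the unique (up to homeomorphism) smallest compactification of the discrete set $X$ to which all functions $k_o(x,\cdot)$, $x\in X$, extend continuously (it does not depend on $o$, up to homeomorphism); the extensions are again denoted $k_o(x,\cdot)$, and $\partial X=\widehat X\setminus X$ is the Martin boundary. The chain converges $\Pr_x$-almost surely to a random variable $Z_\infty$ with values in $\partial X$ for every starting point $x$; the harmonic measures are $\nu_x(A)=\Pr_x(Z_\infty\in A)$ for Borel $A\subseteq\partial X$. They are mutually absolutely continuous, and ''almost every'' on $\partial X$ means with respect to one (equivalently, every) $\nu_x$. A boundary point $\xi\in\partial X$ is regular if for every sequence $(x_n)$ in $X$ converging to $\xi$ in $\widehat X$, the measures $\nu_{x_n}$ converge weakly to $\delta_\xi$, i.e. $\int_{\partial X} f\,d\nu_{x_n}\to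 f(\xi)$ for all $f\in C(\partial X)$. The compactification is almost regular if the set of regular boundary points has $\nu_x$-measure $1$ for some (equivalently, every) $x\in X$. Measures on $X$ are defined on the power set of $X$. For a signed measure $\mu$ of finite variation and $h\in L^1(|\mu|)$, put $L(h,\mu)(x)=\int_X h\,d\mu-\mu(X)h(x)$. $\mu$ has the weak mean value property with respect to $o$ if $L(h,\mu)(o)=0$ for all $h\in\mathcal H^\infty(X,P)$. (In part (b), $\mu$ has finite variation since $1/F(o,\cdot)\ge1$.) *)

(* Defs.v *)
From HB Require Import structures.
From mathcomp Require Import all_boot all_order all_algebra.
From mathcomp Require Import all_classical all_reals all_analysis.

Set Implicit Arguments.
Unset Strict Implicit.
Unset Printing Implicit Defensive.
Import Order.TTheory GRing.Theory Num.Theory.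
Import numFieldNormedType.Exports.

Local Open Scope classical_set_scope.
Local Open Scope ring_scope.

(* Nonempty at most countable sets. The distinguished point is only there
   because measurable types are pointed; nothing below depends on it. *)
#[short(type="pcountType")]
HB.structure Definition PointedCountable := {T of Countable T & Pointed T}.

(* [X] with its power set as sigma-algebra. *)
Definition discrete_space (X : Type) : Type := X.

Section discrete_space.
Variable X : pcountType.
HB.instance Definition _ := PointedCountable.on (discrete_space X).

HB.instance Definition _ := @isMeasurable.Build default_measure_display
  (discrete_space X) discrete_measurable discrete_measurable0
  discrete_measurableC discrete_measurableU.
End discrete_space.

Definition borel_space (K : ptopologicalType) := g_sigma_algebraType (@open K).

Section signed_measures.
Local Open Scope ereal_scope.
Context (X : pcountType) (R : realType).

Record signed_measure := SignedMeasure {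
  smeasure :> set (discrete_space X) -> \bar R ;
  smeasure0 : smeasure set0 = 0 ;
  smeasure_one_sided :
    (forall A, smeasure A != +oo) \/ (forall A, smeasure A != -oo) ;
  smeasure_sigma_additive : sigma_additive smeasure }.

(* The positive and negative parts of the Jordan decomposition are the upper
   and lower variations; every subset of [X] is measurable. *)
Definition pos_part (mu : signed_measure) (A : set (discrete_space X)) :=
  ereal_sup [set mu B | B in [set B | B `<=` A]].

Definition neg_part (mu : signed_measure) (A : set (discrete_space X)) :=
  ereal_sup [set - mu B | B in [set B | B `<=` A]].

Section upper_variation.
Variable f : set (discrete_space X) -> \bar R.
Hypothesis f0 : f set0 = 0.
Hypothesis fs : sigma_additive f.

Let up (A : set (discrete_space X)) :=
  ereal_sup [set f B | B in [set B | B `<=` A]].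

Let up_ge A B : B `<=` A -> f B <= up A.
Proof. by move=> BA; apply: ereal_sup_ubound; exists B. Qed.

Let up_le A c : (forall B, B `<=` A -> f B <= c) -> up A <= c.
Proof. by move=> h; apply: ge_ereal_sup => _ [B BA <-]; exact: h. Qed.

Let up_ge0 A : 0 <= up A.
Proof. by rewrite -f0; apply: up_ge. Qed.

Let up_mono A B : A `<=` B -> up A <= up B.
Proof. by move=> AB; apply: up_le => C CA; apply: up_ge => x /CA /AB. Qed.

Let up0 : up set0 = 0.
Proof.
apply/eqP; rewrite eq_le up_ge0 andbT; apply: up_le => B.
by rewrite subset0 => ->; rewrite f0.
Qed.

Let f_add2 A B : A `&` B = set0 -> f (A `|` B) = f A + f B.
Proof.
move=> AB; have := sigma_additive_is_additive f0 fs.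
by rewrite -semi_additiveE => /(additive2P f0); apply.
Qed.

Let up_superadd A B : A `&` B = set0 -> up A + up B <= up (A `|` B).
Proof.
move=> AB; have [->|SU] := eqVneq (up (A `|` B)) +oo; first exact: leey.
have fin S : S `<=` A `|` B -> up S \is a fin_num.
  move=> /up_mono le; rewrite ge0_fin_numE; last exact: up_ge0.
  by apply: (le_lt_trans le); rewrite ltey.
have fB := fin _ (@subsetUr _ A B); have fU := fin _ (@subset_refl _ (A `|` B)).
rewrite -leeBrDr//; apply: up_le => C CA.
rewrite leeBrDr// addeC; have := up_ge CA.
case fC : (f C) => [c| |] _; last 2 first.
- have := up_ge CA; have := fin _ (@subsetUl _ A B).
  by rewrite fC leye_eq => + /eqP uA; rewrite uA.
- by rewrite addeNy leNye.
rewrite -leeBrDr//; apply: up_le => D DB; rewrite leeBrDr// -fC addeC.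
rewrite -f_add2; first by apply: up_ge; exact: setUSS.
by apply/seteqP; split => // x [/CA Ax /DB Bx]; rewrite -AB.
Qed.

Lemma upper_variation_semi_sigma_additive : semi_sigma_additive up.
Proof.
move=> F _ tF _.
have cvgS : cvgn (fun n => \sum_(0 <= i < n) up (F i)).
  exact: is_cvg_ereal_nneg_natsum.
suff -> : up (\bigcup_n F n) = limn (fun n => \sum_(0 <= i < n) up (F i)) by [].
apply/eqP; rewrite eq_le; apply/andP; split.
  apply: up_le => B BF.
  have tB : trivIset setT (fun i => B `&` F i).
    by apply: trivIset_setIl.
  have <- : \bigcup_i (B `&` F i) = B by rewrite -setI_bigcupr; exact/setIidPl.
  have cB := @fs (fun i => B `&` F i) (fun=> I) tB.
  rewrite -(cvg_lim _ cB)//; apply: lee_lim => //; first by apply/cvg_ex; eexists; exact: cB.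
  by near=> n; apply: lee_sum => i _; apply: up_ge; exact: subIsetr.
apply: lime_le => //; near=> n.
apply: (@le_trans _ _ (up (\big[setU/set0]_(i < n) F i))); last first.
  by apply: up_mono; exact: bigsetU_bigcup.
rewrite big_mkord; elim: (n) => [|m IH]; first by rewrite !big_ord0 up0.
rewrite !big_ord_recr/=; apply: le_trans (up_superadd _); last first.
  apply/seteqP; split => // x []; rewrite -bigcup_mkord => -[k /= km Fkx] Fmx.
  by move: km; rewrite (tF k m) ?ltnn//; exists x.
exact: leeD.
Unshelve. all: by end_near. Qed.

Lemma upper_variation0 : up set0 = 0. Proof. exact: up0. Qed.
Lemma upper_variation_ge0 A : 0 <= up A. Proof. exact: up_ge0. Qed.
End upper_variation.

Section parts.
Variable mu : signed_measure.

Lemma opp_smeasure0 : - mu set0 = 0.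
Proof. by rewrite smeasure0 oppe0. Qed.

Lemma opp_smeasure_sigma_additive :
  sigma_additive (fun A : set (discrete_space X) => - mu A).
Proof.
move=> F mF tF.
rewrite [X in X @ _ --> _](_ : _ =
    (fun n => - \sum_(0 <= i < n) mu (F i))); last first.
  apply/funext => n; apply: sumeN => i j _ _.
  by have [h|h] := smeasure_one_sided mu; rewrite /adde_def;
    rewrite !(negbTE (h _)) ?andbF.
by apply: cvgeN; exact: smeasure_sigma_additive.
Qed.

HB.instance Definition _ := isMeasure.Build _ _ _ (pos_part mu)
  (upper_variation0 (smeasure0 mu)) (upper_variation_ge0 (smeasure0 mu))
  (upper_variation_semi_sigma_additive (smeasure0 mu)
    (@smeasure_sigma_additive mu)).

HB.instance Definition _ := isMeasure.Build _ _ _ (neg_part mu)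
  (upper_variation0 opp_smeasure0) (upper_variation_ge0 opp_smeasure0)
  (upper_variation_semi_sigma_additive opp_smeasure0
    opp_smeasure_sigma_additive).

Definition variation_measure : {measure set (discrete_space X) -> \bar R} :=
  measure_add (pos_part mu) (neg_part mu).

Definition signed_integral (h : X -> R) : R :=
  (\int[pos_part mu]_x h x - \int[neg_part mu]_x h x)%R.

(* [L(h, mu)(x)]; only meaningful for [mu] of finite variation and [h]
   integrable with respect to [variation_measure mu], since [fine] and the
   real-valued integral take junk values otherwise. *)
Definition mean_value_defect (h : X -> R) (x : X) : R :=
  (signed_integral h - fine (mu setT) * h x)%R.
End parts.
End signed_measures.

Section markov_operators.
Context (X : pcountType) (R : realType).
Implicit Types (p : X -> X -> R) (f : X -> R).

Definition stochastic p :=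
  (forall x y, 0 <= p x y) /\
  (forall x, \esum_(y in [set: X]) (p x y)%:E = 1%E).

(* The series is an integral against the counting measure, i.e. an absolutely
   convergent sum. *)
Definition markov_op p f (x : X) : R :=
  \int[@counting (discrete_space X) R]_y (p x y * f y).

Definition harmonic p f :=
  (forall x, (\esum_(y in [set: X]) (p x y * `|f y|)%:E < +oo)%E) /\
  markov_op p f = f.

Definition bounded_harmonic p f :=
  harmonic p f /\ exists M : R, forall x, `|f x| <= M.

Definition weak_mean_value p (mu : signed_measure X R) (o : X) :=
  forall h, bounded_harmonic p h -> mean_value_defect mu h o = 0.
End markov_operators.

Section markov_chains.
Context (X : pcountType) (R : realType) (d : measure_display)
  (W : measurableType d).
Variables (p : X -> X -> R) (Pr : X -> probability W R)
  (Z : nat -> {mfun W >-> discrete_space X}).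

Definition markov_chain := forall (x : X) (n : nat) (a : nat -> X),
  Pr x [set w | forall i, (i <= n)%N -> Z i w = a i] =
  (if a 0 == x then \prod_(i < n) p (a i) (a i.+1) else 0)%:E.

Definition irreducible := forall x y : X,
  exists n, (0 < Pr x [set w | Z n w = y])%E.

Definition transient := forall x : X,
  (Pr x [set w | exists n, (0 < n)%N /\ Z n w = x] < 1)%E.

Definition hitting (x y : X) : R := fine (Pr x [set w | exists n, Z n w = y]).

Definition martin_kernel (o x y : X) : R := hitting x y / hitting o y.
End markov_chains.

Section compactifications.
Context (X : pcountType) (R : realType).

Definition compactification (K : topologicalType) (i : X -> K) :=
  [/\ compact [set: K], hausdorff_space K, injective i,
      open (range i) /\
        (forall x, exists2 U, open U & U `&` range i = [set i x])
    & dense (range i)].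

Definition extends_continuously (K : topologicalType) (i : X -> K)
    (f : X -> R) (g : K -> R) :=
  continuous g /\ forall y, g (i y) = f y.

(* A compactification is smaller than another one when it is the image of the
   latter under a continuous map fixing [X]. *)
Definition martin_compactification (k : X -> X -> X -> R) (o : X)
    (K : topologicalType) (i : X -> K) :=
  [/\ compactification i,
      forall x, exists g, extends_continuously i (k o x) g
    & forall (K' : topologicalType) (i' : X -> K'),
        compactification i' ->
        (forall x, exists g, extends_continuously i' (k o x) g) ->
        exists2 pi : K' -> K, continuous pi & forall x, pi (i' x) = i x].

Definition boundary (K : topologicalType) (i : X -> K) : set K := ~` range i.

(* Unique when it exists, by density of [X]. *)
Definition extended_kernel (k : X -> X -> X -> R) (K : topologicalType)
    (i : X -> K) (o x : X) : K -> R :=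
  get [set g | extends_continuously i (k o x) g].
End compactifications.

Section harmonic_measures.
Context (X : pcountType) (R : realType) (d : measure_display)
  (W : measurableType d) (K : ptopologicalType).
Variables (Pr : X -> probability W R) (i : X -> K).

Definition boundary_limit (Z : nat -> {mfun W >-> discrete_space X})
    (Zoo : {mfun W >-> borel_space K}) :=
  (forall w, boundary i (Zoo w)) /\
  forall x, {ae Pr x, forall w,
    (fun n => i (Z n w)) @ \oo --> (Zoo w : K)}.

Variable Zoo : {mfun W >-> borel_space K}.

(* The boundary is closed, so its Borel sets are the Borel sets of [K] that it
   contains, and the law of [Zoo] on [K] is carried by the boundary. *)
Definition harmonic_measure (x : X) := distribution (Pr x) Zoo.

Definition ae_boundary (Q : K -> Prop) :=
  exists x, {ae harmonic_measure x, forall xi : borel_space K,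
    boundary i xi -> Q xi}.

Definition regular_point (xi : K) :=
  boundary i xi /\
  forall x : nat -> X, (fun n => i (x n)) @ \oo --> xi ->
  forall f : K -> R, {within boundary i, continuous f} ->
    \int[harmonic_measure (x n)]_(z in boundary i) f z @[n --> \oo] --> f xi.

(* "Measure one" is stated as "negligible complement": measurability of the
   set of regular points is not presupposed. *)
Definition almost_regular := ae_boundary regular_point.
End harmonic_measures.

(* Main.v *)
Require Import Defs.
From HB Require Import structures.
From mathcomp Require Import all_boot all_order all_algebra.
From mathcomp Require Import all_classical all_reals all_analysis measurable_realfun.
From mathcomp Require Import lra.

Set Implicit Arguments.
Unset Strict Implicit.
Unset Printing Implicit Defensive.
Import Order.TTheory GRing.Theory Num.Theory.
Import numFieldNormedType.Exports.

Local Open Scope classical_set_scope.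
Local Open Scope ring_scope.

(** Part (a) is the inequality [F x y * F y z <= F x z]: it gives
    [k_x(y,z) <= 1 / F x y] with equality at [z = y], and it makes the functions
    [1 / F x] and [1 / F y] comparable up to constants.

    For (ii) => (i) in part (b), let [h] be harmonic with [|h| <= M] and let [s]
    be a finite subset of [X].  The reduction of [h] on [s], which sends [x] to
    the mean of [h] at the first point of [s] visited from [x], is a potential
    carried by [s] and equals [h] on [s].  Written with the law of the last
    point [L] of [s] that the chain visits, it is [E_x(psi(L))] with
    [|psi| <= M] ([harmonic_last_exit]): the charges of the reductions of
    [M - h] and [M + h] are nonnegative, and they add up to the charge of the
    reduction of [2M].  Since the law of [L] under [Pr_x] has density
    [k_o(x,.)] with respect to its law under [Pr_o] ([last_exit_kernel]),
    [h x = E_o(psi(L) k_o(x,L))] on [s].  Let [s] increase to [X].  Then [L]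
    tends to the boundary limit [Zoo], and there are random variables [Psi_n]
    bounded by [M] with
      [h x = lim E_o(Psi_n k_o(x,Zoo))] for every [x]
    ([boundary_approximation]).  Only the uniform bound on [Psi_n] matters: the
    defect [L(h,mu)(o)] is continuous under this limit, because the integrands
    are dominated by a multiple of [1 / F o], and it commutes with [E_o] by
    Fubini.  So [L(h,mu)(o)] is the limit of [E_o(Psi_n l(Zoo))], where [l(xi)]
    is the defect of [k_o(.,xi)], and this vanishes as soon as [l] does almost
    everywhere.

    For the converse, [l] is bounded and measurable, and
    [h x = E_o(l(Zoo) k_o(x,Zoo))] is bounded and harmonic
    ([poisson_harmonic]), so (i) applies to it.  By Fubini again its defect is
    [E_o(l(Zoo)^2)], hence [l] vanishes almost everywhere.

    The identities between hitting, first entry and last exit probabilities all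
    come from the one-step Markov property and from one maximum principle
    ([max_principle]). *)

(** * Trajectories and the one-step Markov property *)

Section paths.
Variable X : pcountType.

(** The empty set makes this family stable under intersection. *)
Definition cylinders : set (set (nat -> X)) :=
  [set A | A = set0 \/
    exists n a, A = [set b | forall k, (k <= n)%N -> b k = a k]].

(** The product sigma-algebra on trajectories. *)
Definition path_event : set (set (nat -> X)) := <<s cylinders >>.

Definition shift_path (b : nat -> X) : nat -> X := fun n => b n.+1.

Let Om := g_sigma_algebraType cylinders.

Lemma path_eventC A : path_event A -> path_event (~` A).
Proof. exact: (@measurableC _ Om). Qed.

Lemma path_eventI A B : path_event A -> path_event B -> path_event (A `&` B).
Proof. exact: (@measurableI _ Om). Qed.

Lemma path_eventU A B : path_event A -> path_event B -> path_event (A `|` B).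
Proof. exact: (@measurableU _ Om). Qed.

Lemma path_event_bigcup (I : countType) (D : set I) (A : I -> set (nat -> X)) :
  (forall i, D i -> path_event (A i)) -> path_event (\bigcup_(i in D) A i).
Proof.
move=> mA; rewrite bigcup_mkcond.
apply: (@countable_bigcupT_measurable _ Om) => // i.
by case: ifPn => [/set_mem/mA//|_]; exact: (@measurable0 _ Om).
Qed.

Lemma path_event_bigcap (I : countType) (D : set I) (A : I -> set (nat -> X)) :
  (forall i, D i -> path_event (A i)) -> path_event (\bigcap_(i in D) A i).
Proof.
move=> mA; rewrite -[X in path_event X]setCK setC_bigcap.
by apply: path_eventC; apply: path_event_bigcup => i /mA /path_eventC.
Qed.

Lemma path_event_cylinder n a :
  path_event [set b : nat -> X | forall k, (k <= n)%N -> b k = a k].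
Proof. by apply: sub_sigma_algebra; right; exists n, a. Qed.

(** A coordinate event is the union of the cylinders contained in it, and these
    are countably many because [X] is countable. *)
Lemma path_event_at n (D : set X) : path_event [set b | D (b n)].
Proof.
have -> : [set b : nat -> X | D (b n)] =
  \bigcup_(s in [set s : seq X | D (nth point s n)])
    [set b | forall k, (k <= n)%N -> b k = nth point s k].
  apply/seteqP; split => [b /= Db|b [s /= Ds]].
    by exists (mkseq b n.+1) => [/=|k kn]; rewrite nth_mkseq.
  by move=> /(_ n (leqnn n)) ->.
by apply: path_event_bigcup => s _; exact: path_event_cylinder.
Qed.

Lemma path_event_shift S : path_event S -> path_event (shift_path @^-1` S).
Proof.
suff: @path_event `<=` (fun S => path_event (shift_path @^-1` S)) by apply.
apply: smallest_sub; last first.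
  move=> _ [->|[n [a ->]]]; first by rewrite preimage_set0; apply: sub_sigma_algebra; left.
  rewrite [X in path_event X](_ : _ =
      \bigcap_(k in [set k | (k <= n)%N]) [set b | [set a k] (b k.+1)]).
    by apply: path_event_bigcap => k _; exact: (path_event_at k.+1 [set a k]).
  by apply/seteqP; split => w.
split; first by rewrite preimage_set0; apply: sub_sigma_algebra; left.
- by move=> B mB; rewrite setTD preimage_setC; exact: path_eventC.
- by move=> B mB; rewrite preimage_bigcup; exact: path_event_bigcup.
Qed.

Lemma setI_closed_cylinders : setI_closed cylinders.
Proof.
suff H n a m c : (n <= m)%N -> cylinders
    ([set b | forall k, (k <= n)%N -> b k = a k] `&`
     [set b | forall k, (k <= m)%N -> b k = c k]).
  move=> A B [->|[n [a ->]]]; first by left; rewrite set0I.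
  move=> [->|[m [c ->]]]; first by left; rewrite setI0.
  by have [nm|/ltnW mn] := leqP n m; [|rewrite setIC]; exact: H.
move=> nm; have [ac|] := pselect (forall k, (k <= n)%N -> a k = c k).
  right; exists m, c; apply/seteqP; split => [b []//|b bc]; split => // k kn.
  by rewrite ac// bc// (leq_trans kn).
move=> nac; left; rewrite -subset0 => b [ba bc]; apply: nac => k kn.
by rewrite -ba// bc// (leq_trans kn).
Qed.

End paths.

Section bounded_integrals.
Context d (T : measurableType d) (R : realType) (P : probability T R).

Lemma bounded_integrable (f : T -> R) C : measurable_fun setT f ->
  (forall w, `|f w| <= C) -> P.-integrable setT (EFin \o f).
Proof.
move=> mf fC; apply: measurable_bounded_integrable => //.
  by rewrite (le_lt_trans (probability_le1 P measurableT))// ltry.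
exists C; split; first exact: num_real.
by move=> x Cx w _ /=; exact: le_trans (fC w) (ltW Cx).
Qed.

Lemma prob_Rintegral_cst (c : R) : \int[P]_w c = c.
Proof. 
rewrite Rintegral_cst// -[RHS]mulr1; congr (_ * _).
exact: (congr1 fine (probability_setT P)).
Qed.

Lemma prob_Rintegral_indic (A : set T) : measurable A -> \int[P]_w \1_A w = fine (P A).
Proof. by move=> mA; rewrite /Rintegral integral_indic// setIT. Qed.

End bounded_integrals.

Section one_step.
Context (R : realType) (X : pcountType) (p : X -> X -> R)
  (d : measure_display) (W : measurableType d) (Pr : X -> probability W R)
  (Z : nat -> {mfun W >-> discrete_space X}).
Hypothesis chain : markov_chain p Pr Z.

Lemma measurable_discrete d' (T : sigmaRingType d')
  (f : discrete_space X -> T) : measurable_fun setT f.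
Proof. by move=> _ A _; exact: I. Qed.

Definition traj (w : W) : nat -> X := fun n => Z n w.

Definition prob (x : X) (S : set (nat -> X)) : R := fine (Pr x (traj @^-1` S)).

(** The Markov operator as the mean of [f] after one step.  On bounded functions
    it is a probability integral, hence linear and monotone. *)
Definition avg (f : X -> R) (x : X) : R := \int[Pr x]_w f (Z 1 w).

Lemma measurable_at (n : nat) (D : set X) : measurable [set w | D (Z n w)].
Proof.
rewrite -[X in measurable X]setTI.
exact: (@measurable_funPT _ _ _ _ (Z n) measurableT D I).
Qed.

Lemma measurable_traj S : path_event S -> measurable (traj @^-1` S).
Proof.
suff: @path_event X `<=` (fun S => measurable (traj @^-1` S)) by apply.
apply: smallest_sub; last first.
  move=> _ [->|[n [a ->]]]; first by rewrite preimage_set0.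
  rewrite [X in measurable X](_ : _ =
      \bigcap_(k in [set k | (k <= n)%N]) [set w | Z k w = a k]).
    by apply: bigcap_measurableType => k _; exact: (measurable_at k [set a k]).
  by apply/seteqP; split => w.
split; first by rewrite preimage_set0.
- by move=> A mA; rewrite setTD preimage_setC; exact: measurableC.
- by move=> A mA; rewrite preimage_bigcup; exact: bigcupT_measurable.
Qed.

(** [Pr x] is carried by the outcomes that start at [x]. *)
Lemma chain_start x A B : measurable A -> measurable B ->
  (forall w, Z 0 w = x -> A w <-> B w) -> Pr x A = Pr x B.
Proof.
pose S := [set w | Z 0 w = x].
have mS : measurable S by exact: (measurable_at 0 [set x]).
have PS : Pr x S = 1%E.
  have := chain x 0 (fun=> x); rewrite eqxx big_ord0 => <-; congr (Pr x _).
  rewrite /S; apply/seteqP; split => w /= => [Z0 i|]; last exact.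
  by rewrite leqn0 => /eqP ->.
have PSC : Pr x (~` S) = 0%E by rewrite probability_setC// PS subee.
suff H C : measurable C -> Pr x C = Pr x (C `&` S).
  move=> mA mB AB; rewrite (H _ mA) (H _ mB); congr (Pr x _).
  by apply/seteqP; split => w [] /[swap] wS; case: (AB w wS) => ? ?; split; auto.
move=> mC; rewrite {1}(measureDI (Pr x) mC mS) [X in (X + _)%E](_ : _ = 0%E) ?add0e//.
apply: (@subset_measure0 _ _ _ _ _ (~` S)) => //.
- exact: measurableD.
- exact: measurableC.
Qed.

Lemma chain_step x y : Pr x [set w | Z 1 w = y] = (p x y)%:E.
Proof.
pose a n := if n is 0 then x else y.
have := chain x 1 a; rewrite eqxx big_ord1 /= => <-.
apply: chain_start; first exact: (measurable_at 1 [set y]).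
  rewrite [X in measurable X](_ : _ =
      [set w | [set x] (Z 0 w)] `&` [set w | [set y] (Z 1 w)]).
    by apply: measurableI; exact: measurable_at.
  apply/seteqP; split => [w h|w [h0 h1] [|[|]]//].
  by split; [exact: (h 0)|exact: (h 1)].
move=> w Z0; split => [Z1 [|[|]]//|h]; exact: (h 1).
Qed.

(** The two sides are measures in [S] which agree on cylinders, by the product
    formula for the law of the chain.  Cylinders generate the path events and
    are stable under intersection, so that Dynkin's induction applies. *)
Lemma one_step_ereal S x : path_event S ->
  (\int[Pr x]_w Pr (Z 1 w) (traj @^-1` S) =
   Pr x (traj @^-1` (@shift_path X @^-1` S)))%E.
Proof.
have mPr A : measurable_fun [set: W] (fun w => Pr (Z 1 w) A).
  by apply: (@measurableT_comp _ _ _ _ _ _ (fun z : discrete_space X => Pr z A)).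
move: S; apply: (@dynkin_induction _ (g_sigma_algebraType (@cylinders X)) (@cylinders X)).
- by [].
- exact: setI_closed_cylinders.
- rewrite !preimage_setT probability_setT.
  rewrite (@eq_integral _ _ _ _ _ (cst 1%E)).
    by rewrite integral_cst// mul1e; exact: probability_setT.
  by move=> w _; exact: probability_setT.
- move=> _ [->|[n [a ->]]].
    rewrite !preimage_set0 measure0.
    by under eq_integral do rewrite measure0; rewrite integral0.
  pose c k := if k is k'.+1 then a k' else x.
  rewrite [RHS](_ : _ = Pr x [set w | forall i, (i <= n.+1)%N -> Z i w = c i]); last first.
    apply: chain_start.
    + by apply: measurable_traj; apply: path_event_shift; exact: path_event_cylinder.
    + exact: (measurable_traj (path_event_cylinder n.+1 c)).
    + move=> w Z0; split => [h [|i]//|h i]; first exact: (h i).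
      exact: (h i.+1).
  rewrite (chain x n.+1 c) /= eqxx big_ord_recl /=.
  under eq_integral do rewrite (chain _ n a).
  set q := \prod_(i < n) p (a i) (a i.+1).
  rewrite (_ : (fun _ => _) = (fun w => q%:E * (\1_[set w | Z 1 w = a 0] w)%:E)%E).
    have m1 : measurable [set w | Z 1 w = a 0] := measurable_at 1 [set a 0].
    rewrite (@integralZl_indic _ _ _ _ _ measurableT (fun=> [set w | Z 1 w = a 0]) q)//.
      by rewrite integral_indic// setIT muleC EFinM; congr (_ * _)%E; exact: chain_step.
    move=> q0; exfalso; move: q0.
    have : (0 <= Pr (a 0%N) [set w | forall i, (i <= n)%N -> Z i w = a i])%E.
      exact: measure_ge0.
    by rewrite chain eqxx lee_fin leNgt => /negbTE ->.
  apply/funext => w; rewrite indicE; case: eqVneq => [e|ne].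
    by rewrite mem_set ?mule1//= e.
  by rewrite memNset ?mule0// => /= e; rewrite e eqxx in ne.
- move=> S mS IH.
  have mt : measurable (traj @^-1` S) := measurable_traj mS.
  have ms : measurable (traj @^-1` (@shift_path X @^-1` S)) :=
    measurable_traj (path_event_shift mS).
  transitivity (1 - Pr x (traj @^-1` (@shift_path X @^-1` S)))%E; last first.
    by rewrite -(probability_setC (Pr x) ms).
  rewrite -IH.
  transitivity (\int[Pr x]_w (cst 1 w - Pr (Z 1 w) (traj @^-1` S)))%E.
    by apply: eq_integral => w _; exact: (probability_setC (Pr (Z 1 w)) mt).
  have i1 : (Pr x).-integrable setT (cst 1%E : W -> \bar R).
    exact: finite_measure_integrable_cst.
  rewrite integralB//; last first.
    apply: (le_integrable measurableT _ _ i1) => // w _.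
    rewrite abse1 gee0_abs; first exact: probability_le1.
    exact: measure_ge0.
  congr (_ - _)%E; rewrite integral_cst// mul1e; exact: probability_setT.
- move=> F mF tF IH.
  have tt : trivIset setT (fun k => traj @^-1` F k).
    by move=> i j _ _ [w [Fi Fj]]; apply: (tF i j I I); exists (traj w).
  have ts : trivIset setT (fun k => traj @^-1` (@shift_path X @^-1` F k)).
    by move=> i j _ _ [w [Fi Fj]]; apply: (tF i j I I); exists (shift_path (traj w)).
  transitivity (\int[Pr x]_w \sum_(k <oo) Pr (Z 1 w) (traj @^-1` F k))%E.
    apply: eq_integral => w _.
    transitivity (Pr (Z 1 w) (\bigcup_k (traj @^-1` F k))).
      by congr (Pr _ _); apply/seteqP; split => v [k _ Fk]; exists k.
    rewrite measure_bigcup//; last by move=> k _; exact: measurable_traj (mF k).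
    apply: congr_lim; apply/funext => n.
    by apply: eq_bigl => k; rewrite in_setT.
  rewrite integral_nneseries//.
  rewrite [X in Pr _ X](_ : _ = \bigcup_k (traj @^-1` (@shift_path X @^-1` F k))).
    rewrite measure_bigcup//; last by move=> k _; exact: measurable_traj (path_event_shift (mF k)).
    apply: congr_lim; apply/funext => n.
    by apply: eq_big => [i|i _]; [rewrite in_setT|exact: IH].
  by apply/seteqP; split => w [k _ Fk]; exists k.
Qed.

End one_step.

(** * Averages, visits and the maximum principle *)

Lemma ler_norm_sum_mul (R : realDomainType) (I : eqType) (s : seq I) (f a : I -> R) L :
  (forall y, y \in s -> 0 <= a y <= L) ->
  `|\sum_(y <- s) f y * a y| <= (\sum_(y <- s) `|f y|) * L.
Proof.
move=> ha; rewrite (le_trans (ler_norm_sum _ _ _))// mulr_suml.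
rewrite big_seq [leRHS]big_seq; apply: ler_sum => y ys.
by have /andP[a0 a1] := ha y ys; rewrite normrM ler_wpM2l// ger0_norm.
Qed.

Section averaging.
Context (R : realType) (X : pcountType) (p : X -> X -> R)
  (d : measure_display) (W : measurableType d) (Pr : X -> probability W R)
  (Z : nat -> {mfun W >-> discrete_space X}).
Hypothesis chain : markov_chain p Pr Z.

Notation prob := (prob Pr Z).
Notation avg := (avg Pr Z).
Notation traj := (traj Z).

Definition sup_bounded (f : X -> R) := exists C, forall x, `|f x| <= C.

Lemma sup_bounded_cst c : sup_bounded (fun=> c). Proof. by exists `|c|. Qed.

Lemma sup_boundedD f g : sup_bounded f -> sup_bounded g -> sup_bounded (fun x => f x + g x).
Proof.
move=> [C fC] [D gD]; exists (C + D) => x.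
by rewrite (le_trans (ler_normD _ _))// lerD.
Qed.

Lemma sup_boundedZ c f : sup_bounded f -> sup_bounded (fun x => c * f x).
Proof.
by move=> [C fC]; exists (`|c| * C) => x; rewrite normrM ler_wpM2l.
Qed.

Lemma sup_boundedB f g : sup_bounded f -> sup_bounded g -> sup_bounded (fun x => f x - g x).
Proof.
move=> bf bg; have [C H] := sup_boundedD bf (sup_boundedZ (-1) bg).
by exists C => x; have := H x; rewrite mulN1r.
Qed.

Lemma sup_bounded_sum (I : Type) (s : seq I) (f : I -> X -> R) :
  (forall i, sup_bounded (f i)) -> sup_bounded (fun x => \sum_(i <- s) f i x).
Proof.
move=> bf; elim: s => [|i s [C IH]].
  by exists 0 => x; rewrite big_nil normr0.
have [D H] := sup_boundedD (bf i) (ex_intro _ C IH : sup_bounded _).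
by exists D => x; rewrite big_cons.
Qed.

Lemma sup_bounded_max0 f : sup_bounded f -> sup_bounded (fun x => Num.max (f x) 0).
Proof.
move=> [C fC]; exists C => x; have := fC x.
by case: (leP (f x) 0) => //; rewrite normr0 => _; exact: le_trans.
Qed.

Lemma avg_integrable f x : sup_bounded f ->
  (Pr x).-integrable setT (EFin \o (fun w => f (Z 1 w))).
Proof.
move=> [C fC]; apply: (@bounded_integrable _ _ _ _ _ C); last by move=> w; exact: fC.
by apply: (@measurableT_comp _ _ _ _ _ _ (f : discrete_space X -> R)) => //.
Qed.

Lemma avg_cst c x : avg (fun=> c) x = c.
Proof. exact: prob_Rintegral_cst. Qed.

Lemma avgD f g x : sup_bounded f -> sup_bounded g ->
  avg (fun y => f y + g y) x = avg f x + avg g x.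
Proof. by move=> bf bg; rewrite /avg RintegralD//; exact: avg_integrable. Qed.

Lemma avgZ c f x : sup_bounded f -> avg (fun y => c * f y) x = c * avg f x.
Proof. by move=> bf; rewrite /avg RintegralZl//; exact: avg_integrable. Qed.

Lemma avgB f g x : sup_bounded f -> sup_bounded g ->
  avg (fun y => f y - g y) x = avg f x - avg g x.
Proof. by move=> bf bg; rewrite /avg RintegralB//; exact: avg_integrable. Qed.

Lemma avg_sum (I : Type) (s : seq I) (f : I -> X -> R) x :
  (forall i, sup_bounded (f i)) ->
  avg (fun y => \sum_(i <- s) f i y) x = \sum_(i <- s) avg (f i) x.
Proof.
move=> bf; elim: s => [|i s IH].
  rewrite [X in avg X](_ : _ = fun=> 0); first by rewrite avg_cst big_nil.
  by apply/funext => y; rewrite big_nil.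
rewrite [X in avg X](_ : _ = fun y => f i y + \sum_(j <- s) f j y); last first.
  by apply/funext => y; rewrite big_cons.
by rewrite avgD// ?IH ?big_cons//; exact: sup_bounded_sum.
Qed.

Lemma avg_le f g x : sup_bounded f -> sup_bounded g -> (forall y, f y <= g y) ->
  avg f x <= avg g x.
Proof.
by move=> bf bg fg; apply: le_Rintegral => //; exact: avg_integrable.
Qed.

Lemma prob_fin x S : path_event S -> Pr x (traj @^-1` S) = (prob x S)%:E.
Proof.
by move=> mS; rewrite fineK// fin_num_measure//; exact: measurable_traj.
Qed.

Lemma prob_ge0 x S : 0 <= prob x S.
Proof. by apply: fine_ge0; exact: measure_ge0. Qed.

Lemma prob_le x S S' : path_event S -> path_event S' -> S `<=` S' ->
  prob x S <= prob x S'.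
Proof.
move=> mS mS' SS'; rewrite -lee_fin -!prob_fin//.
by apply: le_measure; rewrite ?inE; [exact: measurable_traj..|move=> w /SS'].
Qed.

Lemma prob_le1 x S : path_event S -> prob x S <= 1.
Proof.
by move=> mS; rewrite -lee_fin -prob_fin// probability_le1//; exact: measurable_traj.
Qed.

Lemma sup_bounded_prob S : path_event S -> sup_bounded (prob ^~ S).
Proof. by move=> mS; exists 1 => x; rewrite ger0_norm ?prob_ge0 ?prob_le1. Qed.

Lemma prob_start x S S' : path_event S -> path_event S' ->
  (forall b, b 0 = x -> S b <-> S' b) -> prob x S = prob x S'.
Proof.
move=> mS mS' SS'; congr fine; apply: (chain_start chain);
  [exact: measurable_traj..|].
by move=> w Z0; exact: (SS' (traj w)).
Qed.

Lemma probU x S S' : path_event S -> path_event S' -> S `&` S' = set0 ->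
  prob x (S `|` S') = prob x S + prob x S'.
Proof.
move=> mS mS' SS'; apply: EFin_inj; rewrite EFinD -!prob_fin//; last exact: path_eventU.
rewrite -measureU//; [exact: measurable_traj..|].
rewrite -subset0 => w [Sw S'w]; suff : set0 (traj w) by [].
by rewrite -SS'.
Qed.

Lemma prob_setT x : prob x setT = 1.
Proof. exact: (congr1 fine (probability_setT (Pr x))). Qed.

Lemma prob_set0 x : prob x set0 = 0.
Proof. exact: (congr1 fine (measure0 (Pr x))). Qed.

Lemma prob_shift x S : path_event S ->
  prob x (@shift_path X @^-1` S) = avg (prob ^~ S) x.
Proof.
move=> mS; congr fine; rewrite -(one_step_ereal chain x mS).
by apply: eq_integral => w _ /=; rewrite prob_fin.
Qed.

(** The form in which the Markov property is used below: the probability of an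
    event which the starting point does not influence is harmonic there. *)
Lemma prob_first_step x S : path_event S ->
  (forall b, b 0 = x -> S b <-> S (shift_path b)) -> prob x S = avg (prob ^~ S) x.
Proof.
move=> mS h; rewrite -prob_shift//; apply: prob_start => //.
exact: path_event_shift.
Qed.

Definition visits_from (N : nat) (s : seq X) : set (nat -> X) :=
  [set b | exists n, (N <= n)%N /\ b n \in s].

Lemma path_event_visits_from N s : path_event (visits_from N s).
Proof.
have -> : visits_from N s = \bigcup_(n in [set n | (N <= n)%N]) [set b | [set y | y \in s] (b n)].
  by apply/seteqP; split => b; [move=> [n [Nn bn]]; exists n|move=> [n Nn bn]; exists n].
by apply: path_event_bigcup => n _; exact: (path_event_at n [set y | y \in s]).
Qed.

Lemma visits_from_shift N s : @shift_path X @^-1` (visits_from N s) = visits_from N.+1 s.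
Proof.
apply/seteqP; split => b; first by move=> [n [Nn bn]]; exists n.+1.
by move=> [[|n] [Nn bn]] //; exists n.
Qed.

Lemma prob_visits_shift N s x : prob x (visits_from N.+1 s) = avg (prob ^~ (visits_from N s)) x.
Proof. by rewrite -visits_from_shift prob_shift//; exact: path_event_visits_from. Qed.

Hypothesis escape : forall x y,
  {ae Pr x, forall w, exists N, forall n, (N <= n)%N -> Z n w <> y}.

(** The decreasing events [visits_from N s] shrink to a null event, since the
    chain leaves each of the finitely many points of [s] for good. *)
Lemma prob_visits_cvg0 s x : prob x (visits_from N s) @[N --> \oo] --> (0 : R).
Proof.
have mF N := measurable_traj Z (path_event_visits_from N s).
have mI : measurable (\bigcap_N (traj @^-1` visits_from N s)) by exact: bigcapT_measurable.
have I0 : Pr x (\bigcap_N (traj @^-1` visits_from N s)) = 0%E.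
  have : {ae Pr x, forall w, exists N, forall n, (N <= n)%N -> Z n w \notin s}.
    elim: s {mF mI} => [|y s IH]; first by apply/aeW => w; exists 0%N.
    move: (escape x y) IH; apply: filterS2 => w [N1 h1] [N2 h2].
    exists (maxn N1 N2) => m; rewrite geq_max => /andP[n1 n2].
    by rewrite in_cons negb_or h2// andbT; apply/eqP; exact: h1.
  move=> [A [mA A0 sA]]; apply: subset_measure0 A0 => // w wI; apply: sA => -[N h].
  by have [n [Nn]] := wI N I; rewrite (negbTE (h n Nn)).
apply: (@fine_cvg _ _ _ _ (fun N => Pr x (traj @^-1` visits_from N s)) 0).
rewrite -[X in _ --> X]I0.
apply: (@nonincreasing_cvg_mu _ _ _ (Pr x)) => //.
  by rewrite (le_lt_trans (probability_le1 (Pr x) (mF 0%N)))// ltry.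
move=> m n mn; apply/subsetPset => w [k [nk bk]]; exists k; split => //.
exact: leq_trans nk.
Qed.

(** The positive part [u] of [v] satisfies [u <= avg u].  Iterating this bounds
    [u x] by a multiple of the probability that the chain started at [x] visits
    [s] after time [N], which tends to [0].  Applied to differences this is a
    uniqueness principle: two functions dominated by the hitting probability of
    [s] that solve the same one-step equation are equal. *)
Lemma max_principle s v C : sup_bounded v -> (forall x, v x <= C * prob x (visits_from 0 s)) ->
  (forall x, v x <= 0 \/ v x <= avg v x) -> forall x, v x <= 0.
Proof.
move=> bv vC vavg x; pose u y := Num.max (v y) 0.
have bu : sup_bounded u := sup_bounded_max0 bv.
have uvisits N y : u y <= `|C| * prob y (visits_from N s).
  elim: N y => [|N IH] y.
    rewrite /u ge_max mulr_ge0 ?prob_ge0// andbT (le_trans (vC y))//.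
    by rewrite ler_wpM2r ?prob_ge0// ler_norm.
  rewrite prob_visits_shift -avgZ; last exact: sup_bounded_prob (path_event_visits_from _ _).
  apply: (@le_trans _ _ (avg u y)); last first.
    apply: avg_le => //; apply: sup_boundedZ; exact: sup_bounded_prob (path_event_visits_from _ _).
  have u0 : 0 <= avg u y by rewrite -(avg_cst 0 y); apply: avg_le => //;
    [exact: sup_bounded_cst|move=> z; rewrite le_max lexx orbT].
  rewrite ge_max u0 andbT; case: (vavg y) => [v0|/le_trans]; first exact: le_trans u0.
  by apply; apply: avg_le => // z; rewrite le_max lexx.
suff : u x <= 0 by rewrite ge_max => /andP[].
have cv : `|C| * prob x (visits_from N s) @[N --> \oo] --> `|C| * 0.
  by apply: cvgMr; exact: prob_visits_cvg0.
rewrite -(mulr0 `|C|) -(cvg_lim _ cv)//; apply: limr_ge; first by apply/cvg_ex; eexists; exact: cv.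
by apply: nearW => N; exact: uvisits.
Qed.

End averaging.

(** * Hitting probabilities, Martin kernels and last exits *)

Section potential_theory.
Context (R : realType) (X : pcountType) (p : X -> X -> R)
  (d : measure_display) (W : measurableType d) (Pr : X -> probability W R)
  (Z : nat -> {mfun W >-> discrete_space X}).
Hypothesis chain : markov_chain p Pr Z.
Hypothesis irr : irreducible Pr Z.
Hypothesis escape : forall x y,
  {ae Pr x, forall w, exists N, forall n, (N <= n)%N -> Z n w <> y}.

Notation prob := (prob Pr Z).
Notation avg := (avg Pr Z).
Notation F := (hitting Pr Z).
Notation k := (martin_kernel Pr Z).

Lemma hitting_visits x y : F x y = prob x (visits_from 0 [:: y]).
Proof.
congr (fine (Pr x _)); apply/seteqP; split => w [n].
  by move=> Zn; exists n; rewrite inE; split => //; apply/eqP.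
by move=> [_]; rewrite inE => /eqP Zn; exists n.
Qed.

Lemma prob_visits_in s x : x \in s -> prob x (visits_from 0 s) = 1.
Proof.
move=> xs; rewrite -[RHS](prob_setT Pr Z x); apply: (prob_start chain).
- exact: path_event_visits_from.
- exact: (@measurableT _ (g_sigma_algebraType (@cylinders X))).
- by move=> b b0; split => // _; exists 0%N; rewrite b0.
Qed.

Lemma prob_visits_out s x : x \notin s ->
  prob x (visits_from 0 s) = avg (prob ^~ (visits_from 0 s)) x.
Proof.
move=> xs; apply: (prob_first_step chain); first exact: path_event_visits_from.
move=> b b0; split => [[[|n] [_ bn]]|[n [_ bn]]].
- by rewrite b0 (negbTE xs) in bn.
- by exists n.
- by exists n.+1.
Qed.

Lemma hittingxx x : F x x = 1.
Proof. by rewrite hitting_visits prob_visits_in// inE. Qed.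

Lemma hitting_le1 x y : F x y <= 1.
Proof. by rewrite hitting_visits; apply: prob_le1; exact: path_event_visits_from. Qed.

Lemma hitting_ge0 x y : 0 <= F x y.
Proof. by rewrite hitting_visits prob_ge0. Qed.

Lemma sup_bounded_hitting y : sup_bounded (F ^~ y).
Proof. by exists 1 => x; rewrite ger0_norm ?hitting_ge0 ?hitting_le1. Qed.

Lemma hitting_step x y : x != y -> F x y = avg (F ^~ y) x.
Proof.
move=> xy; rewrite hitting_visits prob_visits_out ?inE//.
by congr (avg _ x); apply/funext => z; rewrite hitting_visits.
Qed.

Lemma hitting_superharmonic x y : avg (F ^~ y) x <= F x y.
Proof.
have [->|/hitting_step ->//] := eqVneq x y.
rewrite hittingxx -(avg_cst Pr Z 1 y); apply: avg_le => [||z].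
- exact: sup_bounded_hitting.
- exact: sup_bounded_cst.
- exact: hitting_le1.
Qed.

Lemma hitting_gt0 x y : 0 < F x y.
Proof.
have [n Pn] := irr x y; rewrite hitting_visits -lte_fin -(prob_fin Pr Z x (path_event_visits_from _ _)).
apply: (lt_le_trans Pn); apply: le_measure; rewrite ?inE.
- exact: (measurable_at Z n [set y]).
- exact: measurable_traj (path_event_visits_from _ _).
- by move=> w Zn; exists n; rewrite inE; split => //; apply/eqP.
Qed.

(** As functions of [x], the left-hand side is harmonic off [y], the right-hand
    side is superharmonic, and they agree at [y]. *)
Lemma hitting_mul x y z : F x y * F y z <= F x z.
Proof.
rewrite -subr_le0.
apply: (max_principle chain escape (s := [:: y]) (C := 1)
  (v := fun x => F x y * F y z - F x z)).
- apply: sup_boundedB; last exact: sup_bounded_hitting.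
  have [C H] := sup_boundedZ (F y z) (sup_bounded_hitting y).
  by exists C => u; rewrite mulrC.
- move=> u; rewrite mul1r -hitting_visits lerBlDr (@le_trans _ _ (F u y))//.
    by rewrite ler_piMr ?hitting_ge0 ?hitting_le1.
  by rewrite lerDl hitting_ge0.
- move=> u; have [->|uy] := eqVneq u y.
    by left; rewrite hittingxx mul1r subrr.
  right.
  rewrite [X in avg X](_ : _ = fun x => F y z * F x y - F x z); last first.
    by apply/funext => ?; rewrite mulrC.
  rewrite avgB ?avgZ//; [|exact: sup_bounded_hitting|exact/sup_boundedZ/sup_bounded_hitting|exact: sup_bounded_hitting].
  by rewrite -hitting_step// mulrC lerD2l lerN2 hitting_superharmonic.
Qed.

Lemma martin_kernel_ge0 o x y : 0 <= k o x y.
Proof. by rewrite divr_ge0// hitting_ge0. Qed.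

Lemma martin_kernel_le o x y : k o x y <= 1 / F o x.
Proof.
rewrite ler_pdivrMr ?hitting_gt0// mulrAC ler_pdivlMr ?hitting_gt0// mul1r mulrC.
exact: hitting_mul.
Qed.

Lemma martin_kernel_diag o x : k o x x = 1 / F o x.
Proof. by rewrite /martin_kernel hittingxx. Qed.

Lemma martin_kernel_oo o y : k o o y = 1.
Proof. by rewrite /martin_kernel divff// gt_eqF// hitting_gt0. Qed.

Lemma martin_kernel_change o o' x y : k o' x y = k o x y * k o' o y.
Proof.
by rewrite /martin_kernel mulrA divfK// gt_eqF// hitting_gt0.
Qed.

Lemma martin_kernel_superharmonic o x y : avg (k o ^~ y) x <= k o x y.
Proof.
rewrite [X in avg X](_ : _ = fun z => (F o y)^-1 * F z y); last first.
  by apply/funext => z; rewrite mulrC.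
rewrite avgZ; last exact: sup_bounded_hitting.
rewrite /martin_kernel [leRHS]mulrC ler_wpM2l ?invr_ge0 ?hitting_ge0//.
exact: hitting_superharmonic.
Qed.

Section last_exit.
Variable s : seq X.

Definition last_exit (y : X) : set (nat -> X) :=
  [set b | exists j, b j = y /\ forall i, (j < i)%N -> b i \notin s].

Definition first_entry (y : X) : set (nat -> X) :=
  [set b | exists j, b j = y /\ forall i, (i < j)%N -> b i \notin s].

(** On [s] this is the equilibrium charge of [s]: the probability of never
    returning to [s]. *)
Definition exit_prob (y : X) : R := 1 - prob y (visits_from 1 s).

Lemma path_event_last_exit y : path_event (last_exit y).
Proof.
rewrite [X in path_event X](_ : _ = \bigcup_j ([set b | [set y] (b j)] `&`
    \bigcap_(i in [set i | (j < i)%N]) [set b | [set u | u \notin s] (b i)])).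
  apply: path_event_bigcup => j _; apply: path_eventI.
    exact: path_event_at.
  by apply: path_event_bigcap => i _; exact: (path_event_at i [set u | u \notin s]).
apply/seteqP; split => b; first by move=> [j [bj h]]; exists j.
by move=> [j _ [bj h]]; exists j.
Qed.

Lemma path_event_first_entry y : path_event (first_entry y).
Proof.
rewrite [X in path_event X](_ : _ = \bigcup_j ([set b | [set y] (b j)] `&`
    \bigcap_(i in [set i | (i < j)%N]) [set b | [set u | u \notin s] (b i)])).
  apply: path_event_bigcup => j _; apply: path_eventI.
    exact: path_event_at.
  by apply: path_event_bigcap => i _; exact: (path_event_at i [set u | u \notin s]).
apply/seteqP; split => b; first by move=> [j [bj h]]; exists j.
by move=> [j _ [bj h]]; exists j.
Qed.

Lemma last_exit_le_hitting x y : prob x (last_exit y) <= F x y.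
Proof.
rewrite hitting_visits; apply: prob_le; [exact: path_event_last_exit|exact: path_event_visits_from|].
by move=> b [j [bj _]]; exists j; rewrite inE; split => //; apply/eqP.
Qed.

(** To leave [s] for the last time at [y] the chain has to reach [y].  Both sides
    are harmonic in [x] off [y], agree at [y], and are at most [F x y]. *)
Lemma last_exit_kernel_hitting x y :
  prob x (last_exit y) = F x y * prob y (last_exit y).
Proof.
pose t u := prob u (last_exit y).
have bt : sup_bounded t := sup_bounded_prob Pr Z (path_event_last_exit y).
have bf : sup_bounded (fun u => t y * F u y) := sup_boundedZ _ (sup_bounded_hitting y).
have t0 u : 0 <= t u := prob_ge0 _ _ _ _.
have t1 u : t u <= 1 := prob_le1 Pr Z u (path_event_last_exit y).
have tF u : t u <= F u y := last_exit_le_hitting u y.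
have step u : u != y -> t u = avg t u.
  move=> uy; apply: (prob_first_step chain); first exact: path_event_last_exit.
  move=> b b0; split => [[[|j] [bj h]]|[j [bj h]]].
  - by rewrite -b0 bj eqxx in uy.
  - by exists j; split => // i ji; exact: (h i.+1).
  - by exists j.+1; split => // -[|i]//; exact: h.
have H u : u = y \/ t u - t y * F u y = avg (fun u => t u - t y * F u y) u.
  have [->|uy] := eqVneq u y; [by left|right].
  by rewrite avgB// avgZ -?step -?hitting_step//; exact: sup_bounded_hitting.
rewrite [RHS]mulrC; apply/eqP; rewrite eq_le; apply/andP; split; rewrite -subr_le0.
- apply: (max_principle chain escape (s := [:: y]) (C := 1)
    (v := fun u => t u - t y * F u y)) => [|u|u].
  + exact: sup_boundedB.
  + rewrite mul1r -hitting_visits lerBlDr (le_trans (tF u))// lerDl.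
    by rewrite mulr_ge0// hitting_ge0.
  + case: (H u) => [->|e]; first by left; rewrite hittingxx mulr1 subrr.
    by right; rewrite -e.
- apply: (max_principle chain escape (s := [:: y]) (C := 1)
    (v := fun u => t y * F u y - t u)) => [|u|u].
  + exact: sup_boundedB.
  + rewrite mul1r -hitting_visits lerBlDr (@le_trans _ _ (F u y))//.
      by rewrite ler_piMl// hitting_ge0.
    by rewrite lerDl.
  + case: (H u) => [->|e]; first by left; rewrite hittingxx mulr1 subrr.
    by right; rewrite avgB// -opprB e avgB// opprB.
Qed.

(** This is where Martin kernels come from: they are the densities of the last
    exit laws for different starting points. *)
Lemma last_exit_kernel o x y :
  prob x (last_exit y) = k o x y * prob o (last_exit y).
Proof.
rewrite (last_exit_kernel_hitting o) last_exit_kernel_hitting /martin_kernel.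
by rewrite mulrA divfK// gt_eqF// hitting_gt0.
Qed.

(** The last visit is either made at time [0] or by the shifted trajectory; these
    cases exclude each other because [y] belongs to [s]. *)
Lemma last_exit_step x y : y \in s ->
  prob x (last_exit y) = (x == y)%:R * exit_prob y + avg (prob ^~ (last_exit y)) x.
Proof.
move=> ys; have [->|xy] := eqVneq x y; last first.
  rewrite mul0r add0r; apply: (prob_first_step chain); first exact: path_event_last_exit.
  move=> b b0; split => [[[|j] [bj h]]|[j [bj h]]].
  - by rewrite -b0 bj eqxx in xy.
  - by exists j; split => // i ji; exact: (h i.+1).
  - by exists j.+1; split => // -[|i]//; exact: h.
have mL := path_event_visits_from 1 s; have mT := path_event_last_exit y.
have mS := path_event_shift mT.
have -> : exit_prob y = prob y (~` visits_from 1 s).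
  apply/eqP; rewrite /exit_prob subr_eq -probU//.
  - by rewrite setUC setUv prob_setT.
  - exact: path_eventC.
  - by rewrite setIC setICr.
rewrite mul1r -(prob_shift chain)// -probU//; last 2 first.
- exact: path_eventC.
- rewrite -subset0 => b [nl [j [bj _]]]; apply: nl; exists j.+1; split => //.
  by rewrite -[b j.+1]/(shift_path b j) bj.
apply: (prob_start chain) => //; first by apply: path_eventU => //; exact: path_eventC.
move=> b b0; split => [[[|j] [bj h]]|[nl|[j [bj h]]]].
- left=> -[[|n] [// _ bn]]; by have := h n.+1 isT; rewrite bn.
- by right; exists j; split => // i ji; exact: (h i.+1).
- by exists 0%N; split => // i i0; apply/negP => bi; apply: nl; exists i.
- by exists j.+1; split => // -[|i]//; exact: h.
Qed.

Lemma first_entry_in x y : x \in s -> prob x (first_entry y) = (x == y)%:R.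
Proof.
move=> xs; have [->|xy] := eqVneq x y.
  rewrite -[RHS](prob_setT Pr Z y); apply: (prob_start chain).
  - exact: path_event_first_entry.
  - exact: (@measurableT _ (g_sigma_algebraType (@cylinders X))).
  - by move=> b b0; split => // _; exists 0%N.
rewrite -[RHS](prob_set0 Pr Z x); apply: (prob_start chain).
- exact: path_event_first_entry.
- exact: (@measurable0 _ (g_sigma_algebraType (@cylinders X))).
- move=> b b0; split => // -[[|j] [bj h]]; first by rewrite -b0 bj eqxx in xy.
  by have := h 0%N isT; rewrite b0 xs.
Qed.

Lemma first_entry_out x y : y \in s -> x \notin s ->
  prob x (first_entry y) = avg (prob ^~ (first_entry y)) x.
Proof.
move=> ys xs; apply: (prob_first_step chain); first exact: path_event_first_entry.
move=> b b0; split => [[[|j] [bj h]]|[j [bj h]]].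
- by move: xs; rewrite -b0 bj ys.
- by exists j; split => // i ji; exact: (h i.+1).
- exists j.+1; split => // -[|i]; [by rewrite b0|exact: h].
Qed.

Lemma first_entry_le_visits x y : y \in s -> prob x (first_entry y) <= prob x (visits_from 0 s).
Proof.
move=> ys; apply: prob_le; [exact: path_event_first_entry|exact: path_event_visits_from|].
by move=> b [j [bj _]]; exists j; rewrite bj.
Qed.

Lemma last_exit_le_visits x y : y \in s -> prob x (last_exit y) <= prob x (visits_from 0 s).
Proof.
move=> ys; apply: prob_le; [exact: path_event_last_exit|exact: path_event_visits_from|].
by move=> b [j [bj _]]; exists j; rewrite bj.
Qed.

End last_exit.
End potential_theory.

(** * Reduction of harmonic functions to finite sets *)

Section balayage.
Context (R : realType) (X : pcountType) (p : X -> X -> R)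
  (d : measure_display) (W : measurableType d) (Pr : X -> probability W R)
  (Z : nat -> {mfun W >-> discrete_space X}).
Hypothesis chain : markov_chain p Pr Z.
Hypothesis irr : irreducible Pr Z.
Hypothesis escape : forall x y,
  {ae Pr x, forall w, exists N, forall n, (N <= n)%N -> Z n w <> y}.
Variable s : seq X.
Hypothesis s_uniq : uniq s.

Notation prob := (prob Pr Z).
Notation avg := (avg Pr Z).

(** The balayage of [f] on [s]: the mean of [f] at the first point of [s] that is
    visited. *)
Definition reduction (f : X -> R) (x : X) : R :=
  \sum_(y <- s) f y * prob x (first_entry s y).

Lemma sup_bounded_reduction f : sup_bounded (reduction f).
Proof.
apply: sup_bounded_sum => y; apply: sup_boundedZ; apply: sup_bounded_prob; exact: path_event_first_entry.
Qed.

Lemma reduction_in f x : x \in s -> reduction f x = f x.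
Proof.
move=> xs; rewrite /reduction (bigD1_seq x)//= (first_entry_in chain)// eqxx mulr1 big1 ?addr0//.
by move=> y yx; rewrite (first_entry_in chain)// eq_sym (negbTE yx) mulr0.
Qed.

Lemma avg_reduction f x :
  avg (reduction f) x = \sum_(y <- s) f y * avg (prob ^~ (first_entry s y)) x.
Proof.
rewrite avg_sum; last first.
  by move=> y; apply: sup_boundedZ; apply: sup_bounded_prob; exact: path_event_first_entry.
by apply: eq_bigr => y _; rewrite avgZ//; apply: sup_bounded_prob; exact: path_event_first_entry.
Qed.

Lemma reduction_out f x : x \notin s -> reduction f x = avg (reduction f) x.
Proof.
move=> xs; rewrite avg_reduction /reduction big_seq [RHS]big_seq.
by apply: eq_bigr => y ys; rewrite (first_entry_out chain).
Qed.

Lemma reduction_le_visits f x :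
  `|reduction f x| <= (\sum_(y <- s) `|f y|) * prob x (visits_from 0 s).
Proof.
by apply: ler_norm_sum_mul => y ys; rewrite prob_ge0 first_entry_le_visits.
Qed.

Lemma reductionB M f x : reduction (fun y => M - f y) x =
  M * reduction (fun=> 1) x - reduction f x.
Proof.
rewrite /reduction mulr_sumr -sumrB; apply: eq_bigr => y _.
by rewrite mul1r mulrBl.
Qed.

(** The difference [reduction f - f] vanishes on [s] and is harmonic off [s]. *)
Lemma reduction_le f : sup_bounded f -> (forall x, 0 <= f x) ->
  (forall x, avg f x = f x) -> forall x, reduction f x <= f x.
Proof.
move=> bf f0 hf x; rewrite -subr_le0.
apply: (max_principle chain escape (s := s) (C := \sum_(y <- s) `|f y|)
  (v := fun x => reduction f x - f x)) => [|u|u].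
- exact: sup_boundedB (sup_bounded_reduction f) bf.
- rewrite lerBlDr (le_trans (ler_norm _))// (le_trans (reduction_le_visits f u))//.
  by rewrite lerDl.
- have [us|us] := boolP (u \in s); first by left; rewrite reduction_in// subrr.
  by right; rewrite avgB//; [rewrite hf -reduction_out//|exact: sup_bounded_reduction].
Qed.

Lemma visits_le_reduction1 x : prob x (visits_from 0 s) <= reduction (fun=> 1) x.
Proof.
have bl := sup_bounded_prob Pr Z (path_event_visits_from 0 s).
rewrite -subr_le0.
apply: (max_principle chain escape (s := s) (C := 1)
  (v := fun x => prob x (visits_from 0 s) - reduction (fun=> 1) x)) => [|u|u].
- exact: sup_boundedB bl (sup_bounded_reduction _).
- rewrite mul1r lerBlDr lerDl; apply: sumr_ge0 => y _.
  by rewrite mul1r prob_ge0.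
- have [us|us] := boolP (u \in s).
    by left; rewrite reduction_in// (prob_visits_in chain)// subrr.
  right; rewrite avgB//; last exact: sup_bounded_reduction.
  by rewrite -reduction_out// -(prob_visits_out chain).
Qed.

(** On [s], the Riesz charge [r - avg r] of the potential [r = reduction h]. *)
Definition reduction_charge (h : X -> R) (y : X) : R := h y - avg (reduction h) y.

Lemma reduction_charge_ge0 h y : sup_bounded h -> (forall x, 0 <= h x) ->
  (forall x, avg h x = h x) -> 0 <= reduction_charge h y.
Proof.
move=> bh h0 hh; rewrite subr_ge0 -[leRHS]hh; apply: avg_le => //.
  exact: sup_bounded_reduction.
exact: reduction_le.
Qed.

(** [M - h] is nonnegative and harmonic, so its charge [M * c - reduction_charge h]
    is nonnegative on [s], where [c] is the charge of the reduction of [1]; and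
    [c <= exit_prob] because the hitting probability of [s] is at most the
    reduction of [1]. *)
Lemma reduction_charge_le M h y : (forall x, `|h x| <= M) ->
  (forall x, avg h x = h x) -> reduction_charge h y <= M * exit_prob Pr Z s y.
Proof.
move=> hM hh; have bh : sup_bounded h by exists M.
have b1 : sup_bounded (reduction (fun=> 1)) := sup_bounded_reduction _.
have M0 : 0 <= M := le_trans (normr_ge0 _) (hM y).
have := @reduction_charge_ge0 (fun x => M - h x) y.
rewrite /reduction_charge; rewrite (_ : reduction _ = fun x => M * reduction (fun=> 1) x - reduction h x).
  rewrite avgB ?avgZ//; [|exact: sup_boundedZ|exact: sup_bounded_reduction] => H.
  apply: (@le_trans _ _ (M - M * avg (reduction (fun=> 1)) y)).
    have {}H := H (sup_boundedB (sup_bounded_cst X M) bh) _ _.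
    suff : 0 <= M - h y - (M * avg (reduction (fun=> 1)) y - avg (reduction h) y).
      by move=> ?; lra.
    apply: H => x; first by rewrite subr_ge0 (le_trans (ler_norm _)).
    by rewrite avgB ?avg_cst ?hh//; exact: sup_bounded_cst.
  rewrite -{1}[M]mulr1 -mulrBr ler_wpM2l// /exit_prob lerD2l lerN2.
  rewrite (prob_visits_shift chain); apply: avg_le => //.
    exact: sup_bounded_prob (path_event_visits_from _ _).
  exact: visits_le_reduction1.
by apply/funext => x; exact: reductionB.
Qed.

Lemma reductionN f x : reduction (fun y => - f y) x = - reduction f x.
Proof. by rewrite /reduction -sumrN; apply: eq_bigr => y _; rewrite mulNr. Qed.

Lemma norm_reduction_charge_le M h y : (forall x, `|h x| <= M) ->
  (forall x, avg h x = h x) -> `|reduction_charge h y| <= M * exit_prob Pr Z s y.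
Proof.
move=> hM hh; rewrite ler_norml reduction_charge_le// andbT lerNl.
have bh : sup_bounded h by exists M.
have avgN f x : sup_bounded f -> avg (fun x => - f x) x = - avg f x.
  move=> bf; rewrite -mulN1r -avgZ//; congr (avg _ _).
  by apply/funext => z; rewrite mulN1r.
have := @reduction_charge_le M (fun x => - h x) y; rewrite /reduction_charge.
rewrite (_ : reduction _ = fun x => - reduction h x); last first.
  by apply/funext => x; exact: reductionN.
rewrite avgN ?opprD; last exact: sup_bounded_reduction.
apply; first by move=> x; rewrite normrN.
by move=> x; rewrite avgN// hh.
Qed.

(** The potential of a charge on [s] is the mean of its density with respect to
    [exit_prob] at the last exit point.  The density [psi] of the charge of [h]
    is bounded by [M], and the mean [g] of [psi] and the reduction of [h] solve
    the same one-step equation. *)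
Theorem harmonic_last_exit M h : (forall x, `|h x| <= M) ->
  (forall x, avg h x = h x) ->
  exists psi : X -> R, (forall y, `|psi y| <= M) /\
    forall x, x \in s -> h x = \sum_(y <- s) psi y * prob x (last_exit s y).
Proof.
move=> hM hh; have M0 : 0 <= M := le_trans (normr_ge0 _) (hM point).
have cM y := norm_reduction_charge_le y hM hh.
have e0 y : 0 <= exit_prob Pr Z s y.
  by rewrite subr_ge0 prob_le1//; exact: path_event_visits_from.
pose psi y := reduction_charge h y / exit_prob Pr Z s y.
(* where [exit_prob] vanishes, so does the charge, and [psi y] is [0] *)
have psie y : psi y * exit_prob Pr Z s y = reduction_charge h y.
  rewrite /psi; have [e|ne] := eqVneq (exit_prob Pr Z s y) 0; last by rewrite divfK.
  by rewrite e mulr0; apply/esym/eqP; rewrite -normr_le0 (le_trans (cM y))// e mulr0.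
have psiM y : `|psi y| <= M.
  rewrite normrM normfV (ger0_norm (e0 y)).
  have [->|ne] := eqVneq (exit_prob Pr Z s y) 0; first by rewrite invr0 mulr0.
  by rewrite ler_pdivrMr// lt_neqAle eq_sym ne e0.
exists psi; split => // x xs.
pose g u := \sum_(y <- s) psi y * prob u (last_exit s y).
have bt y : sup_bounded (prob ^~ (last_exit s y)).
  by apply: sup_bounded_prob; exact: path_event_last_exit.
have bg : sup_bounded g by apply: sup_bounded_sum => y; exact: sup_boundedZ.
have gE u : g u = (if u \in s then reduction_charge h u else 0) + avg g u.
  rewrite avg_sum; last by move=> y; exact: sup_boundedZ.
  rewrite /g (eq_big_seq (fun y => (u == y)%:R * reduction_charge h y +
      psi y * avg (prob ^~ (last_exit s y)) u)); last first.
    by move=> y ys; rewrite (last_exit_step chain)// mulrDr mulrCA psie.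
  rewrite big_split /=; congr (_ + _); last by apply: eq_bigr => y _; rewrite avgZ.
  case: ifPn => us.
    rewrite (bigD1_seq u)//= eqxx mul1r big1 ?addr0// => y yu.
    by rewrite eq_sym (negbTE yu) mul0r.
  rewrite big_seq big1// => y ys; rewrite (_ : (u == y) = false) ?mul0r//.
  by apply/negbTE/eqP => uy; rewrite uy ys in us.
have rE u : reduction h u = (if u \in s then reduction_charge h u else 0) + avg (reduction h) u.
  case: ifPn => us; last by rewrite add0r -reduction_out.
  by rewrite /reduction_charge subrK reduction_in.
have gvisits u : `|g u| <= (\sum_(y <- s) `|psi y|) * prob u (visits_from 0 s).
  by apply: ler_norm_sum_mul => y ys; rewrite prob_ge0 last_exit_le_visits.
have br : sup_bounded (reduction h) := sup_bounded_reduction h.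
pose C := \sum_(y <- s) `|psi y| + \sum_(y <- s) `|h y|.
rewrite -[LHS](reduction_in h xs) -/(g x).
apply/eqP; rewrite eq_le; apply/andP; split; rewrite -subr_le0.
- apply: (max_principle chain escape (s := s) (C := C)
    (v := fun u => reduction h u - g u)) => [|u|u].
  + exact: sup_boundedB.
  + rewrite (le_trans (ler_norm _))// (le_trans (ler_normB _ _))// addrC mulrDl.
    by apply: lerD => //; exact: reduction_le_visits.
  + by right; rewrite avgB//; move: (gE u) (rE u); set c := if _ then _ else _; lra.
- apply: (max_principle chain escape (s := s) (C := C)
    (v := fun u => g u - reduction h u)) => [|u|u].
  + exact: sup_boundedB.
  + rewrite (le_trans (ler_norm _))// (le_trans (ler_normB _ _))// mulrDl.
    by apply: lerD => //; exact: reduction_le_visits.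
  + by right; rewrite avgB//; move: (gE u) (rE u); set c := if _ then _ else _; lra.
Qed.
End balayage.

(** * Extension of Martin kernels to the compactification *)

Section dominated.
Context d (T : measurableType d) (R : realType).

Lemma Rintegral_dominated_cvg (mu : {measure set T -> \bar R})
    (f_ : nat -> T -> R) (f g : T -> R) :
  (forall n, measurable_fun setT (f_ n)) -> measurable_fun setT f ->
  {ae mu, forall w, f_ n w @[n --> \oo] --> f w} ->
  mu.-integrable setT (EFin \o g) ->
  (forall n w, `|f_ n w| <= g w) ->
  \int[mu]_w f_ n w @[n --> \oo] --> \int[mu]_w f w.
Proof.
move=> mf_ mf cvf ig fg.
have mEf_ n : measurable_fun setT (EFin \o f_ n) by exact/measurable_EFinP.
have mEf : measurable_fun setT (EFin \o f) by exact/measurable_EFinP.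
have cvE : {ae mu, forall w, setT w -> (EFin \o f_ n) w @[n --> \oo] --> (EFin \o f) w}.
  by apply: filterS cvf => w h _; apply: cvg_EFin => //; apply: nearW.
have leE : {ae mu, forall w n, setT w -> (`|(EFin \o f_ n) w| <= (EFin \o g) w)%E}.
  by apply/aeW => w n _; rewrite lee_fin.
have [iF _ H] := dominated_convergence measurableT mEf_ mEf cvE ig leE.
apply: (@fine_cvg _ _ _ _ (fun n => \int[mu]_w (f_ n w)%:E)%E).
by rewrite fineK//; exact: integrable_fin_num iF.
Qed.

End dominated.

Section extended_kernels.
Context (R : realType) (X : pcountType) (p : X -> X -> R)
  (d : measure_display) (W : measurableType d) (Pr : X -> probability W R)
  (Z : nat -> {mfun W >-> discrete_space X})
  (K : ptopologicalType) (i : X -> K) (Zoo : {mfun W >-> borel_space K})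
  (base : X).
Notation F := (hitting Pr Z).
Notation k := (martin_kernel Pr Z).
Hypothesis dense_i : dense (range i).

Lemma dense_le (g : K -> R) c : continuous g -> (forall y, g (i y) <= c) ->
  forall xi, g xi <= c.
Proof.
move=> cg gc xi; rewrite leNgt; apply/negP => gxi.
have oO : open (g @^-1` [set r | c < r]).
  by apply: open_comp; [move=> ? _; exact: cg|exact: open_gt].
have [z0 [gz [z _ iz]]] := dense_i (ex_intro _ xi gxi) oO.
by move: gz; rewrite -iz /= ltNge gc.
Qed.

Lemma dense_ge (g : K -> R) c : continuous g -> (forall y, c <= g (i y)) ->
  forall xi, c <= g xi.
Proof.
move=> cg gc xi; rewrite -lerN2; apply: (@dense_le (fun z => - g z)).
  by move=> z; apply: cvgN; exact: cg.
by move=> y; rewrite lerN2.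
Qed.

Lemma dense_eq (g h : K -> R) : continuous g -> continuous h ->
  (forall y, g (i y) = h (i y)) -> forall xi, g xi = h xi.
Proof.
move=> cg ch gh xi; apply/eqP; rewrite -subr_eq0 eq_le.
have cgh : continuous (fun z => g z - h z).
  by move=> z; apply: cvgB; [exact: cg|exact: ch].
rewrite (@dense_le (fun z => g z - h z))//= => [|y]; last by rewrite gh subrr.
by apply: (@dense_ge (fun z => g z - h z)) => // y; rewrite gh subrr.
Qed.

Lemma measurable_continuous_borel (g : K -> R) : continuous g ->
  measurable_fun (setT : set (borel_space K)) (g : borel_space K -> R).
Proof.
move=> cg; apply: (measurability _ (RGenOInfty.measurableE R)).
move=> /= _ [_ [a ->]] <-; apply: measurableI => //.
apply: sub_sigma_algebra; rewrite /= set_itvE.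
by apply: open_comp; [move=> ? _; exact: cg|exact: open_gt].
Qed.

Lemma measurable_Zoo (g : borel_space K -> R) : measurable_fun setT g ->
  measurable_fun setT (fun w => g (Zoo w)).
Proof. by move=> mg; exact: measurableT_comp. Qed.

Hypothesis chain : markov_chain p Pr Z.
Hypothesis irr : irreducible Pr Z.
Hypothesis escape : forall x y,
  {ae Pr x, forall w, exists N, forall n, (N <= n)%N -> Z n w <> y}.
Hypothesis base_ext : forall x, exists g, extends_continuously i (k base x) g.

Notation khat := (extended_kernel k i).

(** [k_o(x,.)] is the quotient of [k_base(x,.)] by [k_base(o,.)], and the latter
    is at least [F o base], hence nonzero on the whole compactification. *)
Lemma extended_kernelP o x : extends_continuously i (k o x) (khat o x).
Proof.
rewrite /extended_kernel; apply: (@getPex _ [set g | extends_continuously i (k o x) g]).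
have [gx [cx ex]] := base_ext x; have [go [co eo]] := base_ext o.
have go_gt0 xi : 0 < go xi.
  apply: lt_le_trans (hitting_gt0 irr o base) _; apply: dense_ge => // y.
  rewrite eo /martin_kernel ler_pdivlMr ?(hitting_gt0 irr)//.
  exact: (hitting_mul chain escape).
exists (fun xi => gx xi / go xi); split.
  by move=> xi; apply: cvgM; [exact: cx|apply: cvgV; [rewrite gt_eqF|exact: co]].
move=> y; rewrite ex eo /martin_kernel invf_div mulrA divfK//.
by rewrite gt_eqF// (hitting_gt0 irr).
Qed.

Lemma extended_kernel_continuous o x : continuous (khat o x).
Proof. by case: (extended_kernelP o x). Qed.

Lemma extended_kernelE o x y : khat o x (i y) = k o x y.
Proof. by case: (extended_kernelP o x). Qed.

Lemma extended_kernel_ge0 o x xi : 0 <= khat o x xi.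
Proof.
apply: dense_ge (@extended_kernel_continuous o x) _ _ => y.
by rewrite extended_kernelE martin_kernel_ge0.
Qed.

Lemma extended_kernel_le o x xi : khat o x xi <= 1 / F o x.
Proof.
apply: dense_le (@extended_kernel_continuous o x) _ _ => y.
by rewrite extended_kernelE (martin_kernel_le chain irr escape).
Qed.

Lemma extended_kernel_norm o x xi : `|khat o x xi| <= 1 / F o x.
Proof. by rewrite ger0_norm ?extended_kernel_ge0 ?extended_kernel_le. Qed.

Lemma extended_kernel_oo o xi : khat o o xi = 1.
Proof.
apply: (@dense_eq _ (cst 1)) => //.
- exact: extended_kernel_continuous.
- by move=> ?; exact: cvg_cst.
- by move=> y; rewrite extended_kernelE (martin_kernel_oo irr).
Qed.

Lemma extended_kernel_change o o' x xi : khat o' x xi = khat o x xi * khat o' o xi.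
Proof.
apply: (@dense_eq _ (fun xi => khat o x xi * khat o' o xi)).
- exact: extended_kernel_continuous.
- by move=> z; apply: cvgM; exact: extended_kernel_continuous.
- by move=> y; rewrite !extended_kernelE (martin_kernel_change irr o).
Qed.

Lemma measurable_extended_kernel o x :
  measurable_fun setT (fun w => khat o x (Zoo w)).
Proof.
apply: (@measurable_Zoo (khat o x)); apply: measurable_continuous_borel.
exact: extended_kernel_continuous.
Qed.

Lemma ereal_sup_extended_kernel o x :
  ereal_sup [set (khat o x z)%:E | z in [set: K]] = (1 / F o x)%:E.
Proof.
apply/eqP; rewrite eq_le; apply/andP; split.
  by apply: ge_ereal_sup => _ [z _ <-]; rewrite lee_fin extended_kernel_le.
apply: ereal_sup_ubound; exists (i x) => //.
by rewrite extended_kernelE (martin_kernel_diag chain).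
Qed.

End extended_kernels.

(** * Boundary representation of bounded harmonic functions *)

Section Rintegral_sum.
Context d (T : measurableType d) (R : realType) (mu : {measure set T -> \bar R}).

Lemma Rintegral_sum (I : Type) (s : seq I) (f : I -> T -> R) :
  (forall y, mu.-integrable setT (EFin \o f y)) ->
  mu.-integrable setT (EFin \o (fun w => \sum_(y <- s) f y w)) /\
  \int[mu]_w (\sum_(y <- s) f y w) = \sum_(y <- s) \int[mu]_w f y w.
Proof.
move=> fi; elim: s => [|y s [iS eS]].
  rewrite (_ : (fun w => \sum_(y <- [::]) f y w) = fun=> 0); last first.
    by apply/funext => w; rewrite big_nil.
  split; first exact: integrable0.
  by rewrite big_nil Rintegral_cst// mul0r.
rewrite (_ : (fun w => \sum_(z <- y :: s) f z w) =
    fun w => f y w + \sum_(z <- s) f z w); last first.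
  by apply/funext => w; rewrite big_cons.
split; last by rewrite RintegralD// eS big_cons.
by apply: (integrableD measurableT (fi y) iS).
Qed.

End Rintegral_sum.

Section boundary_representation.
Context (R : realType) (X : pcountType) (p : X -> X -> R)
  (d : measure_display) (W : measurableType d) (Pr : X -> probability W R)
  (Z : nat -> {mfun W >-> discrete_space X})
  (K : ptopologicalType) (i : X -> K) (Zoo : {mfun W >-> borel_space K})
  (base : X).
Notation F := (hitting Pr Z).
Notation k := (martin_kernel Pr Z).
Notation khat := (extended_kernel k i).
Notation avg := (avg Pr Z).
Notation prob := (prob Pr Z).
Hypothesis dense_i : dense (range i).
Hypothesis chain : markov_chain p Pr Z.
Hypothesis irr : irreducible Pr Z.
Hypothesis escape : forall x y,
  {ae Pr x, forall w, exists N, forall n, (N <= n)%N -> Z n w <> y}.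
Hypothesis base_ext : forall x, exists g, extends_continuously i (k base x) g.
Hypothesis limit : forall x, {ae Pr x, forall w,
  (fun n => i (Z n w)) @ \oo --> (Zoo w : K)}.

Let khat_norm := extended_kernel_norm dense_i chain irr escape base_ext.
Let khatE := extended_kernelE dense_i chain irr escape base_ext.
Let khat_continuous := extended_kernel_continuous dense_i chain irr escape base_ext.
Let measurable_khat := measurable_extended_kernel Zoo dense_i chain irr escape base_ext.

(** The last exit events of [s] are pairwise disjoint, so such a sum has at most
    one nonzero term. *)
Lemma last_exit_sum (s : seq X) (b : nat -> X) (a : X -> R) : uniq s ->
  \sum_(y <- s) \1_(last_exit s y) b * a y = 0 \/
  exists j, [/\ b j \in s, forall m, (j < m)%N -> b m \notin s &
    \sum_(y <- s) \1_(last_exit s y) b * a y = a (b j)].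
Proof.
move=> us; have [[j [bj hj]]|nj] :=
    pselect (exists j, b j \in s /\ forall m, (j < m)%N -> b m \notin s).
  right; exists j; split => //; rewrite (bigD1_seq (b j))//= indicE mem_set; last first.
    by exists j.
  rewrite mul1r big_seq_cond big1 ?addr0// => y /andP[ys ybj].
  rewrite indicE memNset ?mul0r// => -[j' [bj' hj']].
  have [jj'|j'j|jj'] := ltngtP j j'.
  - by have := hj _ jj'; rewrite bj' ys.
  - by have := hj' _ j'j; rewrite bj.
  - by move: ybj; rewrite -bj' jj' eqxx.
left; rewrite big_seq big1// => y ys.
rewrite indicE memNset ?mul0r// => -[j [bj hj]]; apply: nj.
by exists j; rewrite bj.
Qed.

Definition exhaustion (n : nat) : seq X := undup (pmap unpickle (iota 0 n)).

Lemma mem_exhaustion n x : (pickle x < n)%N -> x \in exhaustion n.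
Proof.
move=> xn; rewrite mem_undup mem_pmap; apply/mapP; exists (pickle x).
  by rewrite mem_iota.
by rewrite pickleK.
Qed.

(** [Psi n] is the density [psi] of [harmonic_last_exit] evaluated at the last
    exit point of the [n]-th set of an exhaustion, and [0] if that set is never
    visited.  Replacing [k_o(x,.)] at the last exit point by its value at [Zoo]
    costs [Delta n], which tends to [0] since the last exit points follow the
    trajectory to [Zoo]. *)
Theorem boundary_approximation o (M : R) h : (forall x, `|h x| <= M) ->
  (forall x, avg h x = h x) ->
  exists Psi : nat -> W -> R, [/\ forall n, measurable_fun setT (Psi n),
    forall n w, `|Psi n w| <= M &
    forall x, \int[Pr o]_w (Psi n w * khat o x (Zoo w)) @[n --> \oo] --> h x].
Proof.
move=> hM hh; have M0 : 0 <= M := le_trans (normr_ge0 _) (hM point).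
have us n : uniq (exhaustion n) := undup_uniq _.
have /choice[psi psiP] : forall n, exists psi : X -> R, (forall y, `|psi y| <= M) /\
    forall x, x \in exhaustion n ->
      h x = \sum_(y <- exhaustion n) psi y * prob x (last_exit (exhaustion n) y).
  by move=> n; exact: (harmonic_last_exit chain escape).
pose T n y := last_exit (exhaustion n) y.
pose S n (a : X -> R) w := \sum_(y <- exhaustion n) \1_(T n y) (traj Z w) * a y.
have mind n y : measurable_fun setT (fun w => \1_(T n y) (traj Z w) : R).
  rewrite (_ : (fun w => _) = \1_(traj Z @^-1` T n y)); last by apply/funext => w.
  apply: measurable_indic; apply: measurable_traj; exact: path_event_last_exit.
have mS n (a : X -> W -> R) : (forall y, measurable_fun setT (a y)) ->
    measurable_fun setT (fun w => S n (a ^~ w) w).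
  move=> ma; apply: measurable_sum => y; exact: measurable_funM.
have SM n a (B : R) w : (forall y, `|a y| <= B) -> `|S n a w| <= B.
  move=> aB; rewrite /S /T; have [->|[j [_ _ ->]]//] := last_exit_sum (traj Z w) a (us n).
  by rewrite normr0 (le_trans (normr_ge0 (a point))).
have mPsi n : measurable_fun setT (S n (psi n)).
  by apply: (mS n (fun y _ => psi n y)) => y; exact: measurable_cst.
exists (fun n => S n (psi n)); split => [//|n w|x].
  by apply: SM; case: (psiP n).
pose A n w := S n (fun y => psi n y * k o x y) w.
pose Delta n w := S n (fun y => psi n y * (khat o x (Zoo w) - k o x y)) w.
have mA n : measurable_fun setT (A n).
  by apply: (mS n (fun y _ => psi n y * k o x y)) => y; exact: measurable_cst.
have C0 : 0 <= 1 / F o x by rewrite (le_trans (normr_ge0 _) (khat_norm o x point)).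
have kle y : `|k o x y| <= 1 / F o x.
  by rewrite ger0_norm ?martin_kernel_ge0 ?(martin_kernel_le chain irr escape).
have intA n : (pickle x < n)%N -> \int[Pr o]_w A n w = h x.
  move=> xn; have [_ /(_ _ (mem_exhaustion xn)) ->] := psiP n.
  have := @Rintegral_sum _ _ _ (Pr o) _ (exhaustion n)
    (fun y w => \1_(T n y) (traj Z w) * (psi n y * k o x y)).
  case=> [y|_ ->].
    apply: (@bounded_integrable _ _ _ _ _ `|psi n y * k o x y|).
      by apply: measurable_funM => //; exact: measurable_cst.
    move=> w; rewrite normrM indicE; case: (_ \in _); rewrite ?normr1 ?mul1r//.
    by rewrite normr0 mul0r.
  apply: eq_bigr => y _; rewrite (last_exit_kernel chain irr escape _ o) mulrA.
  have -> : prob o (last_exit (exhaustion n) y) =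
      \int[Pr o]_w \1_(T n y) (traj Z w).
    rewrite -[RHS]/(\int[Pr o]_w \1_(traj Z @^-1` T n y) w) prob_Rintegral_indic//.
    by apply: measurable_traj; exact: path_event_last_exit.
  rewrite -RintegralZl//; last first.
    apply: (@bounded_integrable _ _ _ _ _ 1); first exact: mind.
    by move=> w; rewrite indicE; case: (_ \in _); rewrite ?normr1// normr0.
  by apply: eq_Rintegral => w _; rewrite mulrC.
have DeltaE n w : S n (psi n) w * khat o x (Zoo w) = A n w + Delta n w.
  rewrite /A /Delta /S -big_split /= mulr_suml; apply: eq_bigr => y _.
  by rewrite -mulrDr -mulrDr addrC subrK mulrA.
have mDelta n : measurable_fun setT (Delta n).
  apply: (mS n (fun y w => psi n y * (khat o x (Zoo w) - k o x y))) => y.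
  apply: measurable_funM; first exact: measurable_cst.
  by apply: measurable_funB; [exact: measurable_khat|exact: measurable_cst].
have aB n w y : `|psi n y * (khat o x (Zoo w) - k o x y)| <= M * (1 / F o x + 1 / F o x).
  rewrite normrM ler_pM//; first by case: (psiP n).
  by rewrite (le_trans (ler_normB _ _))// lerD.
have iA n : (Pr o).-integrable setT (EFin \o A n).
  apply: (@bounded_integrable _ _ _ _ _ (M * (1 / F o x))) => // w; apply: SM => y.
  by rewrite normrM ler_pM//; case: (psiP n).
have iD n : (Pr o).-integrable setT (EFin \o Delta n).
  by apply: (@bounded_integrable _ _ _ _ _ (M * (1 / F o x + 1 / F o x))) => // w; exact: SM.
have cvD : \int[Pr o]_w Delta n w @[n --> \oo] --> (0 : R).
  rewrite -[X in _ --> X](prob_Rintegral_cst (Pr o) 0).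
  apply: (@Rintegral_dominated_cvg _ _ _ (Pr o) Delta (fun=> 0)
    (fun=> M * (1 / F o x + 1 / F o x))) => //.
  - apply: filterS (limit o) => w cvw.
    apply/cvgrPdist_le => /= e e0.
    have ck : (fun n => k o x (Z n w)) @ \oo --> khat o x (Zoo w).
      rewrite (_ : (fun n => _) = khat o x \o (fun n => i (Z n w))).
        by apply: continuous_cvg => //; exact: khat_continuous.
      by apply/funext => n /=; rewrite khatE.
    have e1 : 0 < e / (M + 1) by rewrite divr_gt0// ltr_wpDl.
    move/cvgrPdist_le : ck => /(_ _ e1)[J _ HJ].
    near=> n; rewrite sub0r normrN.
    have JS : Z J w \in exhaustion n.
      by apply: mem_exhaustion; near: n; exists (pickle (Z J w)).+1.
    rewrite /Delta /S /T; have [->|[j [js hj ->]]] := last_exit_sum (traj Z w)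
      (fun y => psi n y * (khat o x (Zoo w) - k o x y)) (us n).
      by rewrite normr0 ltW.
    (* the last visit comes after time [J], when the set is visited *)
    have Jj : (J <= j)%N.
      by rewrite leqNgt; apply/negP => jJ; have := hj _ jJ; rewrite JS.
    rewrite normrM (@le_trans _ _ (M * (e / (M + 1))))//.
      by apply: ler_pM => //; [case: (psiP n)|exact: (HJ j)].
    rewrite mulrCA -[leRHS]mulr1 ler_wpM2l ?(ltW e0)// ler_pdivrMr ?ltr_wpDl// mul1r.
    by rewrite lerDl.
  - exact: finite_measure_integrable_cst.
  - by move=> n w; exact: SM.
rewrite -[X in _ --> X]addr0.
apply: (@cvg_trans _ ((\int[Pr o]_w A n w + \int[Pr o]_w Delta n w) @[n --> \oo])).
  apply: near_eq_cvg; near=> n.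
  by rewrite -RintegralD//; apply: eq_Rintegral => w _; rewrite DeltaE.
apply: cvgD => //; apply: (@cvg_trans _ (h x @[n --> \oo])); last exact: cvg_cst.
apply: near_eq_cvg; near=> n; rewrite intA//.
by near: n; exists (pickle x).+1.
Unshelve. all: by end_near. Qed.

(** Approximate the constant [1] by [Psi n <= 1].  At [x = o], where the kernel is
    [1], this gives [E_o(1 - Psi n) --> 0]; as the kernel at [x] is bounded,
    [E_o(Psi n * k_o(x,Zoo))] and [E_o(k_o(x,Zoo))] have the same limit. *)
Lemma integral_extended_kernel o x : \int[Pr o]_w khat o x (Zoo w) = 1.
Proof.
have [||Psi [mPsi Psi1 cvP]] := @boundary_approximation o 1 (fun=> 1).
- by move=> y; rewrite normr1.
- by move=> y; rewrite avg_cst.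
have C0 : 0 <= 1 / F o x by rewrite (le_trans (normr_ge0 _) (khat_norm o x point)).
have mP n y : measurable_fun setT (fun w => Psi n w * khat o y (Zoo w)).
  by apply: measurable_funM => //; exact: measurable_khat.
have iP n y : (Pr o).-integrable setT (EFin \o (fun w => Psi n w * khat o y (Zoo w))).
  apply: (@bounded_integrable _ _ _ _ _ (1 * (1 / F o y))) => //.
  by move=> w; rewrite normrM ler_pM.
have ik y : (Pr o).-integrable setT (EFin \o (fun w => khat o y (Zoo w))).
  by apply: (@bounded_integrable _ _ _ _ _ (1 / F o y)); [exact: measurable_khat|].
suff cv : \int[Pr o]_w (khat o x (Zoo w)) - \int[Pr o]_w (Psi n w * khat o x (Zoo w))
    @[n --> \oo] --> (0 : R).
  have cv' : \int[Pr o]_w (khat o x (Zoo w)) - \int[Pr o]_w (Psi n w * khat o x (Zoo w))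
      @[n --> \oo] --> \int[Pr o]_w (khat o x (Zoo w)) - 1.
    by apply: cvgB; [exact: cvg_cst|exact: cvP].
  by apply/eqP; rewrite -subr_eq0; apply/eqP; exact: (cvg_unique _ cv' cv).
have cvo : 1 / F o x * (1 - \int[Pr o]_w (Psi n w * khat o o (Zoo w)))
    @[n --> \oo] --> 1 / F o x * (1 - 1).
  by apply: cvgMr; apply: cvgB; [exact: cvg_cst|exact: cvP].
rewrite subrr mulr0 in cvo.
apply: (squeeze_cvgr _ (cvg_cst 0) cvo); near=> n.
have oo := extended_kernel_oo dense_i chain irr escape base_ext o.
have i1 : (Pr o).-integrable setT (EFin \o (fun w => 1 - Psi n w * khat o o (Zoo w))).
  apply: (@bounded_integrable _ _ _ _ _ (1 + 1 * (1 / F o o))).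
    by apply: measurable_funB; [exact: measurable_cst|exact: mP].
  move=> w; rewrite (le_trans (ler_normB _ _))// normr1 lerD2l.
  by rewrite normrM ler_pM.
rewrite -RintegralB//; apply/andP; split.
  apply: Rintegral_ge0 => w _; rewrite subr_ge0 ler_piMl//.
    exact: extended_kernel_ge0 dense_i chain irr escape base_ext _ _ _.
  exact: le_trans (ler_norm _) (Psi1 n w).
rewrite -[X in _ * (X - _)](prob_Rintegral_cst (Pr o) 1) -RintegralB//; last 1 first.
  exact: finite_measure_integrable_cst.
rewrite -RintegralZl//; apply: le_Rintegral => //.
- exact: (integrableB measurableT (ik x) (iP n x)).
- exact: (integrableZl measurableT (1 / F o x) i1).
- move=> w _; rewrite oo mulr1 -[X in X - _]mul1r -mulrBl mulrC.
  rewrite ler_wpM2r ?subr_ge0 ?(le_trans (ler_norm _) (Psi1 n w))//.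
  exact: extended_kernel_le dense_i chain irr escape base_ext _ _ _.
Unshelve. all: by end_near. Qed.

End boundary_representation.

(** * Integrals over a countable discrete space *)

Section discrete_integrals.
Context (X : pcountType) (R : realType).
Local Notation D := (discrete_space X).

(** Cutting the space along the enumeration of [X] reduces integrals to sums over
    atoms. *)
Lemma eq_ge0_integral_atoms (m1 m2 : {measure set D -> \bar R}) (f1 f2 : D -> \bar R) :
  (forall y, 0 <= f1 y)%E -> (forall y, 0 <= f2 y)%E ->
  (forall y, f1 y * m1 [set y] = f2 y * m2 [set y])%E ->
  (\int[m1]_y f1 y = \int[m2]_y f2 y)%E.
Proof.
move=> f10 f20 e12; pose A n := [set y : D | pickle (y : X) = n].
have AT : \bigcup_n A n = setT by apply/seteqP; split => // y _; exists (pickle (y : X)).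
have tA : trivIset setT A by move=> m n _ _ [y [/= <- <-]].
have atom (m : {measure set D -> \bar R}) (f : D -> \bar R) :
    (forall y, 0 <= f y)%E ->
    (\int[m]_y f y = \sum_(n <oo) \int[m]_(y in A n) f y)%E.
  by move=> f0; rewrite -AT ge0_integral_bigcup.
rewrite !atom//; apply: eq_eseriesr => n _.
have [[y Ay]|nA] := pselect (exists y, A n y); last first.
  rewrite (_ : A n = set0) ?integral_set0//.
  by rewrite -subset0 => y Ay; apply: nA; exists y.
have -> : A n = [set y].
  apply/seteqP; split => [z Az|_ -> //]; apply: (pcan_inj (@pickleK X)).
  by rewrite [LHS]Az [RHS]Ay.
have cst1 (m : {measure set D -> \bar R}) (f : D -> \bar R) :
    (\int[m]_(z in [set y]) f z = f y * m [set y])%E.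
  rewrite (@eq_integral _ _ _ _ _ (cst (f y))); last by move=> z; rewrite inE => ->.
  by rewrite integral_cst//; exact: I.
by rewrite !cst1.
Qed.

Lemma eq_Rintegral_atoms (m1 m2 : {measure set D -> \bar R}) (f1 f2 : D -> R) :
  (forall y, m1 [set y] \is a fin_num) -> (forall y, m2 [set y] \is a fin_num) ->
  (forall y, (f1 y)%:E * m1 [set y] = (f2 y)%:E * m2 [set y])%E ->
  \int[m1]_y f1 y = \int[m2]_y f2 y.
Proof.
move=> fin1 fin2 e12; congr fine; rewrite integralE [RHS]integralE.
have H (f : D -> R) (m : {measure set D -> \bar R}) y : m [set y] \is a fin_num ->
    ((EFin \o f)^\+ y * m [set y] = maxe ((f y)%:E * m [set y]) 0)%E /\
    ((EFin \o f)^\- y * m [set y] = maxe (- ((f y)%:E * m [set y])) 0)%E.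
  by move=> fm; rewrite funeposE funenegE !maxe_pMl ?measure_ge0// !mul0e mulNe.
congr (_ - _)%E; apply: eq_ge0_integral_atoms => y.
- exact: funepos_ge0.
- exact: funepos_ge0.
- by rewrite !(H _ _ _ _).1// e12.
- exact: funeneg_ge0.
- exact: funeneg_ge0.
- by rewrite !(H _ _ _ _).2// e12.
Qed.

Lemma counting_set1 (y : D) : counting [set y] = 1%E :> \bar R.
Proof.
rewrite /counting; case: ifPn => [_|]; last by rewrite notin_setE => -[]; exact: finite_set1.
by rewrite fset_set1 finmap.cardfs1.
Qed.
End discrete_integrals.

Section markov_op_average.
Context (R : realType) (X : pcountType) (p : X -> X -> R)
  (d : measure_display) (W : measurableType d) (Pr : X -> probability W R)
  (Z : nat -> {mfun W >-> discrete_space X}).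
Hypothesis chain : markov_chain p Pr Z.
Hypothesis sto : stochastic p.
Notation avg := (avg Pr Z).

Lemma avg_distribution f x : sup_bounded f ->
  avg f x = \int[distribution (Pr x) (Z 1)]_(y in [set: discrete_space X]) f y.
Proof.
move=> bf; congr fine.
by rewrite (@integral_distribution _ _ _ _ _ (Pr x) (Z 1) (EFin \o f))//; exact: (avg_integrable Pr Z x bf).
Qed.

Lemma markov_op_avg f : sup_bounded f -> markov_op p f = avg f.
Proof.
move=> bf; apply/funext => x; rewrite avg_distribution// /markov_op.
have atom (y : discrete_space X) : distribution (Pr x) (Z 1) [set y] = (p x y)%:E.
  exact: (chain_step chain).
apply: eq_Rintegral_atoms => y.
- have : counting [set y] \is a (@fin_num R) by rewrite counting_set1.
  exact.
- have : distribution (Pr x) (Z 1) [set y] \is a fin_num by rewrite atom.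
  exact.
- rewrite [X in (_ * X = _)%E]counting_set1 [X in (_ = _ * X)%E]atom.
  by rewrite mule1 -EFinM mulrC.
Qed.

Lemma bounded_harmonicP f :
  bounded_harmonic p f <->
  (exists M, forall x, `|f x| <= M) /\ forall x, avg f x = f x.
Proof.
split => [[[_ hf] bf]|[bf hf]].
  by split => // x; rewrite -markov_op_avg// hf.
split => //; split; last by rewrite markov_op_avg//; apply/funext.
move=> x; have [M fM] := bf; have [p0 p1] := sto.
apply: (@le_lt_trans _ _ M%:E); last exact: ltry.
apply: ge_ereal_sup => _ [A [finA _] <-].
apply: (@le_trans _ _ (\sum_(y \in A) (M%:E * (p x y)%:E))%E).
  apply: lee_fsum => // y _; rewrite -EFinM lee_fin mulrC ler_wpM2r//.
rewrite -ge0_mule_fsumr; last by move=> y; rewrite lee_fin.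
rewrite -[leRHS]mule1; apply: lee_wpmul2l.
  by rewrite lee_fin (le_trans (normr_ge0 _) (fM x)).
by rewrite -(p1 x); apply: ereal_sup_ubound; exists A.
Qed.
End markov_op_average.

Section discrete_fubini.
Context (X : pcountType) (R : realType) (d : measure_display) (T : measurableType d).
Local Notation D := (discrete_space X).

(** A preimage is a countable union of rectangles over points of [X]. *)
Lemma measurable_discrete_prod d' (Y : sigmaRingType d') (f : D * T -> Y) :
  (forall x, measurable_fun setT (fun t => f (x, t))) -> measurable_fun setT f.
Proof.
move=> mf _ B mB; rewrite setTI.
have -> : f @^-1` B = \bigcup_(x in [set: X]) ([set (x : D)] `*` ((fun t => f (x, t)) @^-1` B)).
  apply/seteqP; split => [[x t] fB|[x t] [y _ [/= -> ]]//].
  by exists x.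
apply: countable_bigcupT_measurable => // x; apply: measurableX; first exact: I.
by rewrite -[X in measurable X]setTI; exact: mf.
Qed.

Variable m : {finite_measure set D -> \bar R}.
Variables (g : D -> R) (G : D -> T -> R).
Hypothesis ig : m.-integrable setT (EFin \o g).
Hypothesis mG : forall x, measurable_fun setT (G x).
Hypothesis Gg : forall x t, `|G x t| <= g x.

Lemma integrable_section t : m.-integrable setT (EFin \o (G ^~ t)).
Proof.
apply: (le_integrable measurableT _ _ ig); first exact: measurable_discrete.
by move=> x _ /=; rewrite lee_fin (le_trans (Gg x t))// ler_norm.
Qed.

Lemma measurable_discrete_integral : measurable_fun setT (fun t => \int[m]_x G x t).
Proof.
pose f (z : D * T) : \bar R := (G z.1 z.2)%:E.
have mf : measurable_fun setT f.
  apply: measurable_discrete_prod => x; apply/measurable_EFinP; exact: mG.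
rewrite (_ : (fun t => _) = fine \o (fubini_G m f^\+ \- fubini_G m f^\-)%E).
  apply: measurableT_comp => //; apply: emeasurable_funB.
    apply: measurable_fun_fubini_tonelli_G; first exact: measurable_funepos.
    by move=> z; exact: funepos_ge0.
  apply: measurable_fun_fubini_tonelli_G; first exact: measurable_funeneg.
  by move=> z; exact: funeneg_ge0.
apply/funext => t; rewrite /Rintegral integralE /=; congr (fine (_ - _)).
  by apply: eq_integral => x _; rewrite !funeposE.
by apply: eq_integral => x _; rewrite !funenegE.
Qed.

Lemma discrete_integral_le t : `|\int[m]_x G x t| <= \int[m]_x g x.
Proof.
rewrite (le_trans (le_normr_Rintegral _ (integrable_section t)))//.
apply: le_Rintegral => //.
by apply: integrable_abse (integrable_section t).
Qed.

Lemma discrete_fubini (P : probability T R) (Phi : T -> R) (M : R) :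
  measurable_fun setT Phi -> (forall t, `|Phi t| <= M) ->
  \int[m]_x (\int[P]_t (Phi t * G x t)) = \int[P]_t (Phi t * \int[m]_x G x t).
Proof.
move=> mPhi PhiM; have M0 : 0 <= M := le_trans (normr_ge0 _) (PhiM point).
pose f (z : D * T) : \bar R := (Phi z.2 * G z.1 z.2)%:E.
have mfx x : measurable_fun setT (fun t => Phi t * G x t) by exact: measurable_funM.
have mf : measurable_fun setT f.
  by apply: measurable_discrete_prod => x; apply/measurable_EFinP; exact: mfx.
have fMg x t : `|Phi t * G x t| <= M * g x by rewrite normrM ler_pM.
have iM : m.-integrable setT (EFin \o (fun x => M * g x)).
  exact: (integrableZl measurableT M ig).
have ix x : P.-integrable setT (EFin \o (fun t => Phi t * G x t)).
  by apply: (@bounded_integrable _ _ _ _ _ (M * g x)).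
have if_ : (m \x P)%E.-integrable setT f.
  apply/(integrable12ltyP m P mf).
  apply: (@le_lt_trans _ _ (\int[m]_x `|(M * g x)%:E|)%E); last first.
    by case/integrableP : iM.
  apply: ge0_le_integral => //.
  - by move=> x _; exact: integral_ge0.
  - move=> x _; apply: (@le_trans _ _ (\int[P]_t (cst (M * g x)%:E t))%E).
      apply: ge0_le_integral => //.
      + by apply: measurableT_comp => //; apply/measurable_EFinP; exact: mfx.
      + by move=> t _; rewrite lee_fin.
    rewrite integral_cst// [X in (_ * X)%E](probability_setT P) mule1.
    by rewrite lee_fin ler_norm.
have := Fubini if_.
rewrite (_ : (fun x => _) = fun x : D => (\int[P]_t (Phi t * G x t))%:E); last first.
  apply/funext => x; rewrite fineK//; exact: integrable_fin_num (ix x).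
rewrite [in X in _ = X -> _](_ : (fun t => _) = fun t => (Phi t * \int[m]_x G x t)%:E); last first.
  apply/funext => t; rewrite -RintegralZl ?fineK//; last exact: integrable_section.
  apply: integrable_fin_num => //.
  exact: (integrableZl measurableT (Phi t) (integrable_section t)).
by move=> /(congr1 fine).
Qed.

End discrete_fubini.

(** * The mean value defect under limits and averages *)

Section mean_value_defect.
Context (X : pcountType) (R : realType) (mu : signed_measure X R) (g : X -> R).
Local Notation D := (discrete_space X).
Hypothesis g1 : forall x, 1 <= g x.
Hypothesis ig : (variation_measure mu).-integrable setT (EFin \o (g : D -> R)).

Lemma integrable_parts :
  (pos_part mu).-integrable setT (EFin \o (g : D -> R)) /\
  (neg_part mu).-integrable setT (EFin \o (g : D -> R)).
Proof.
have mg : measurable_fun setT (EFin \o (g : D -> R)) by move=> _ B _; exact: I.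
have /integrableP[_ ] := ig.
rewrite ge0_integral_measure_add// => lt.
split; apply/integrableP; split => //; apply: le_lt_trans lt.
  by rewrite leeDl// integral_ge0.
by rewrite leeDr// integral_ge0.
Qed.

(** The dominating function is at least [1]. *)
Lemma finite_of_integrable (m : {measure set D -> \bar R}) :
  m.-integrable setT (EFin \o (g : D -> R)) -> fin_num_fun m.
Proof.
move=> /integrableP[_ im] A mA; rewrite ge0_fin_numE//.
apply: (le_lt_trans _ im); apply: (@le_trans _ _ (m setT)).
  by apply: le_measure; rewrite ?inE//; exact: I.
rewrite -[leLHS]mul1e -integral_cst//; apply: ge0_le_integral => //.
by move=> x _ /=; rewrite lee_fin (le_trans (g1 x))// ler_norm.
Qed.

Lemma finite_pos : fin_num_fun (pos_part mu).
Proof. exact: finite_of_integrable integrable_parts.1. Qed.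

Lemma finite_neg : fin_num_fun (neg_part mu).
Proof. exact: finite_of_integrable integrable_parts.2. Qed.

(** The parts of the Jordan decomposition, bundled as finite measures so that
    product measures can be formed. *)
Definition finite_pos_part : {finite_measure set D -> \bar R} :=
  HB.pack (pos_part mu) (Measure_isFinite.Build _ _ _ (pos_part mu) finite_pos).

Definition finite_neg_part : {finite_measure set D -> \bar R} :=
  HB.pack (neg_part mu) (Measure_isFinite.Build _ _ _ (neg_part mu) finite_neg).

Lemma mean_value_defect_cvg (a : nat -> X -> R) (h : X -> R) (C : R) o :
  (forall n x, `|a n x| <= C * g x) ->
  (forall x, a n x @[n --> \oo] --> h x) ->
  mean_value_defect mu (a n) o @[n --> \oo] --> mean_value_defect mu h o.
Proof.
move=> aC ah; rewrite /mean_value_defect /signed_integral.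
have cv (m : {measure set D -> \bar R}) :
    m.-integrable setT (EFin \o (g : D -> R)) ->
    \int[m]_x a n x @[n --> \oo] --> \int[m]_x h x.
  move=> im; apply: (@Rintegral_dominated_cvg _ D _ m a h (fun x => C * g x)) => //.
  - by apply/aeW => x; exact: ah.
  - exact: (integrableZl measurableT C im).
apply: cvgB; first by apply: cvgB; apply: cv; [exact: integrable_parts.1|exact: integrable_parts.2].
by apply: cvgMr; exact: ah.
Qed.

Context d (T : measurableType d) (P : probability T R) (G : X -> T -> R).
Hypothesis mG : forall x, measurable_fun setT (G x).
Hypothesis Gg : forall x t, `|G x t| <= g x.

Lemma measurable_mean_value_defect o :
  measurable_fun setT (fun t => mean_value_defect mu (G ^~ t) o).
Proof.
apply: measurable_funB; last by apply: measurable_funM => //; exact: measurable_cst.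
apply: measurable_funB.
  exact: (@measurable_discrete_integral _ _ _ _ finite_pos_part G mG).
exact: (@measurable_discrete_integral _ _ _ _ finite_neg_part G mG).
Qed.

Lemma mean_value_defect_bounded o :
  exists B, forall t, `|mean_value_defect mu (G ^~ t) o| <= B.
Proof.
exists (\int[pos_part mu]_x g x + \int[neg_part mu]_x g x + `|fine (mu setT)| * g o) => t.
rewrite (le_trans (ler_normB _ _))// lerD//.
  rewrite (le_trans (ler_normB _ _))// lerD//.
    exact: (@discrete_integral_le _ _ _ _ finite_pos_part g G integrable_parts.1 Gg).
  exact: (@discrete_integral_le _ _ _ _ finite_neg_part g G integrable_parts.2 Gg).
by rewrite normrM ler_wpM2l.
Qed.

Lemma mean_value_defect_integral (Phi : T -> R) (M : R) o :
  measurable_fun setT Phi -> (forall t, `|Phi t| <= M) ->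
  mean_value_defect mu (fun x => \int[P]_t (Phi t * G x t)) o =
  \int[P]_t (Phi t * mean_value_defect mu (G ^~ t) o).
Proof.
move=> mPhi PhiM; have M0 : 0 <= M := le_trans (normr_ge0 _) (PhiM point).
have H (m : {finite_measure set D -> \bar R}) :
    m.-integrable setT (EFin \o (g : D -> R)) ->
    \int[m]_x (\int[P]_t (Phi t * G x t)) = \int[P]_t (Phi t * \int[m]_x G x t) /\
    P.-integrable setT (EFin \o (fun t => Phi t * \int[m]_x G x t)).
  move=> im; split; first exact: (discrete_fubini im mG Gg P mPhi PhiM).
  apply: (@bounded_integrable _ _ _ _ _ (M * \int[m]_x g x)).
    by apply: measurable_funM => //; exact: (measurable_discrete_integral m mG).
  by move=> t; rewrite normrM ler_pM//; exact: (discrete_integral_le im Gg).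
have [e1 i1] := H finite_pos_part integrable_parts.1.
have [e2 i2] := H finite_neg_part integrable_parts.2.
have io : P.-integrable setT (EFin \o (fun t => Phi t * G o t)).
  apply: (@bounded_integrable _ _ _ _ _ (M * g o)); first exact: measurable_funM.
  by move=> t; rewrite normrM ler_pM.
rewrite /mean_value_defect /signed_integral [X in X - _ - _]e1 [X in _ - X - _]e2.
rewrite -RintegralB// -RintegralZl// -RintegralB//; last 2 first.
- exact: (integrableB measurableT i1 i2).
- exact: (integrableZl measurableT (fine (mu setT)) io).
by apply: eq_Rintegral => t _; rewrite !mulrBr mulrCA.
Qed.

End mean_value_defect.

(** * Poisson integrals *)

Lemma le_limn_einf (R : realType) (u v : (\bar R)^nat) :
  (forall n, u n <= v n)%E -> (limn_einf u <= limn_einf v)%E.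
Proof.
move=> uv; rewrite !limn_einf_lim; apply: lee_lim; [exact: is_cvg_einfs..|].
apply: nearW => n; apply: le_ereal_inf_tmp => _ [m /= nm <-].
by apply: le_trans (uv m); apply: ereal_inf_lbound; exists m.
Qed.

Section poisson_integral.
Context (R : realType) (X : pcountType) (p : X -> X -> R)
  (d : measure_display) (W : measurableType d) (Pr : X -> probability W R)
  (Z : nat -> {mfun W >-> discrete_space X})
  (K : ptopologicalType) (i : X -> K) (Zoo : {mfun W >-> borel_space K})
  (base : X).
Notation F := (hitting Pr Z).
Notation k := (martin_kernel Pr Z).
Notation khat := (extended_kernel k i).
Notation avg := (avg Pr Z).
Hypothesis dense_i : dense (range i).
Hypothesis chain : markov_chain p Pr Z.
Hypothesis irr : irreducible Pr Z.
Hypothesis escape : forall x y,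
  {ae Pr x, forall w, exists N, forall n, (N <= n)%N -> Z n w <> y}.
Hypothesis base_ext : forall x, exists g, extends_continuously i (k base x) g.
Hypothesis limit : forall x, {ae Pr x, forall w,
  (fun n => i (Z n w)) @ \oo --> (Zoo w : K)}.

Let khat_ge0 := extended_kernel_ge0 dense_i chain irr escape base_ext.
Let khat_norm := extended_kernel_norm dense_i chain irr escape base_ext.
Let khatE := extended_kernelE dense_i chain irr escape base_ext.
Let khat_continuous := extended_kernel_continuous dense_i chain irr escape base_ext.
Let measurable_khat := measurable_extended_kernel Zoo dense_i chain irr escape base_ext.
Let khat_int := integral_extended_kernel dense_i chain irr escape base_ext limit.
Local Notation D := (discrete_space X).
Local Notation step x := (distribution (Pr x) (Z 1)).

(** Fatou's lemma along the trajectory: each [k_o(.,Z_n)] is superharmonic and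
    they tend to [k_o(.,Zoo)].  The integral is extended-valued because the
    limit may be unbounded on [X]. *)
Lemma extended_kernel_superharmonic o x w :
  (fun n => i (Z n w)) @ \oo --> (Zoo w : K) ->
  (\int[step x]_(y in [set: D]) (khat o y (Zoo w))%:E <= (khat o x (Zoo w))%:E)%E.
Proof.
move=> cvw.
have cvk y : (k o y (Z n w))%:E @[n --> \oo] --> (khat o y (Zoo w))%:E.
  have cvr : (fun n => k o y (Z n w)) @ \oo --> khat o y (Zoo w).
    rewrite (_ : (fun n => _) = khat o y \o (fun n => i (Z n w))).
      by apply: continuous_cvg => //; exact: khat_continuous.
    by apply/funext => n /=; rewrite khatE.
  by apply: cvg_EFin => //; exact: nearW.
have bk z : sup_bounded (fun y => k o y z).
  have [C H] := sup_boundedZ ((F o z)^-1) (sup_bounded_hitting Pr Z z).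
  by exists C => u; rewrite /martin_kernel mulrC.
have := @fatou _ _ _ (step x) setT measurableT
  (fun n (y : D) => (k o y (Z n w))%:E).
move=> /(_ (fun n => measurable_discrete _) (fun n y _ => martin_kernel_ge0 _ _ _ _ _)).
rewrite (_ : (fun y => limn_einf _) = fun y => (khat o y (Zoo w))%:E); last first.
  by apply/funext => y; rewrite (cvg_limn_einf_sup (cvk y)).1.
move=> /le_trans; apply; rewrite -(cvg_limn_einf_sup (cvk x)).1.
apply: le_limn_einf => n.
apply: (@le_trans _ _ (avg (fun y => k o y (Z n w)) x)%:E); last first.
  by rewrite lee_fin (martin_kernel_superharmonic chain).
rewrite avg_distribution// fineK//.
apply: integrable_fin_num => //; have [C kC] := bk (Z n w).
by apply: (@bounded_integrable _ _ _ _ _ C) => //; exact: measurable_discrete.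
Qed.

Definition poisson_integral o (phi : W -> R) (x : X) : R :=
  \int[Pr o]_w (phi w * khat o x (Zoo w)).

Lemma poisson_integrable o (phi : W -> R) (B : R) x : measurable_fun setT phi ->
  (forall w, `|phi w| <= B) ->
  (Pr o).-integrable setT (EFin \o (fun w => phi w * khat o x (Zoo w))).
Proof.
move=> mphi phiB; apply: (@bounded_integrable _ _ _ _ _ (B * (1 / F o x))).
  by apply: measurable_funM => //; exact: measurable_khat.
by move=> w; rewrite normrM ler_pM.
Qed.

Lemma poisson_cst o (B : R) x : poisson_integral o (fun=> B) x = B.
Proof.
rewrite /poisson_integral RintegralZl//; first by rewrite khat_int mulr1.
apply: (@bounded_integrable _ _ _ _ _ (1 / F o x)); last by move=> w; exact: khat_norm.
exact: measurable_khat.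
Qed.

Lemma poisson_le o (phi : W -> R) (B : R) x : measurable_fun setT phi ->
  (forall w, `|phi w| <= B) -> `|poisson_integral o phi x| <= B.
Proof.
move=> mphi phiB; have i1 := poisson_integrable o x mphi phiB.
have B0 : 0 <= B := le_trans (normr_ge0 _) (phiB point).
rewrite -[leRHS](poisson_cst o B x) (le_trans (le_normr_Rintegral _ i1))//.
apply: le_Rintegral => //.
- exact: integrable_abse i1.
- by apply: (@poisson_integrable o (fun=> B) B) => // w; rewrite ger0_norm.
- by move=> w _; rewrite normrM (ger0_norm (khat_ge0 _ _ _)) ler_wpM2r.
Qed.

Lemma poisson_superharmonic o (phi : W -> R) (B : R) x : measurable_fun setT phi ->
  (forall w, 0 <= phi w <= B) ->
  avg (poisson_integral o phi) x <= poisson_integral o phi x.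
Proof.
move=> mphi phi0B.
have phiB w : `|phi w| <= B by have /andP[? ?] := phi0B w; rewrite ger0_norm.
have phi0 w : 0 <= phi w by have /andP[] := phi0B w.
have ip y := poisson_integrable o y mphi phiB.
have bp : sup_bounded (poisson_integral o phi) by exists B => y; exact: poisson_le.
pose f (z : D * W) : \bar R := (phi z.2 * khat o z.1 (Zoo z.2))%:E.
have mf : measurable_fun setT f.
  apply: measurable_discrete_prod => y; apply/measurable_EFinP.
  by apply: measurable_funM => //; exact: measurable_khat.
have f0 z : (0 <= f z)%E by rewrite lee_fin mulr_ge0.
have inner y : (\int[Pr o]_w f (y, w))%E = (poisson_integral o phi y)%:E.
  by rewrite fineK//; exact: integrable_fin_num (ip y).
rewrite -lee_fin avg_distribution// fineK; last first.
  apply: integrable_fin_num => //.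
  by apply: (@bounded_integrable _ _ _ _ _ B) => [|y]; [exact: measurable_discrete|exact: poisson_le].
rewrite -inner (_ : (fun y => (poisson_integral o phi y)%:E) = fun y => (\int[Pr o]_w f (y, w))%E); last first.
  by apply/funext => y; rewrite inner.
rewrite (fubini_tonelli (m1 := step x) (m2 := Pr o) f)//.
apply: ae_ge0_le_integral => //.
- by move=> w _; exact: integral_ge0.
- exact: measurable_fun_fubini_tonelli_G.
- by apply/measurable_EFinP; apply: measurable_funM => //; exact: measurable_khat.
apply: filterS (limit o) => w cvw _.
rewrite /fubini_G /f /=.
under eq_integral do rewrite EFinM.
rewrite ge0_integralZl_EFin//; last by move=> y _; rewrite lee_fin.
by rewrite EFinM lee_wpmul2l ?lee_fin//; exact: extended_kernel_superharmonic.
Qed.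

Lemma poissonB o (phi psi : W -> R) (B C : R) x : measurable_fun setT phi ->
  (forall w, `|phi w| <= B) -> measurable_fun setT psi -> (forall w, `|psi w| <= C) ->
  poisson_integral o (fun w => phi w - psi w) x =
  poisson_integral o phi x - poisson_integral o psi x.
Proof.
move=> mphi phiB mpsi psiC.
rewrite -RintegralB//; [|exact: poisson_integrable phiB|exact: poisson_integrable psiC].
by apply: eq_Rintegral => w _; rewrite mulrBl.
Qed.

(** The Poisson integrals of [phi + B] and [B - phi] are superharmonic, and they
    are [B] plus and minus that of [phi], because the kernels have mean [1]. *)
Theorem poisson_harmonic o (phi : W -> R) (B : R) x : measurable_fun setT phi ->
  (forall w, `|phi w| <= B) ->
  avg (poisson_integral o phi) x = poisson_integral o phi x.
Proof.
move=> mphi phiB; have B0 : 0 <= B := le_trans (normr_ge0 _) (phiB point).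
have mB : measurable_fun setT (fun _ : W => B) by exact: measurable_cst.
have normB w : `|(fun _ : W => B) w| <= B by rewrite ger0_norm.
have mN : measurable_fun setT (fun w => phi w - - B).
  by apply: measurable_funB => //; exact: measurable_cst.
have normN (w : W) : `|- B| <= B by rewrite normrN ger0_norm.
have mNB : measurable_fun setT (fun _ : W => - B) by exact: measurable_cst.
have bp (f : W -> R) : measurable_fun setT f -> (forall w, `|f w| <= B) -> sup_bounded (poisson_integral o f).
  by move=> mf fB; exists B => y; exact: poisson_le.
have absB w : - B <= phi w <= B by rewrite -ler_norml.
have := @poisson_superharmonic o (fun w => B - phi w) (B + B) x.
rewrite (_ : poisson_integral o _ = fun y => B - poisson_integral o phi y); last first.
  by apply/funext => y; rewrite (poissonB _ _ mB normB mphi phiB) poisson_cst.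
have := @poisson_superharmonic o (fun w => phi w - - B) (B + B) x mN.
rewrite (_ : poisson_integral o _ = fun y => poisson_integral o phi y - - B); last first.
  by apply/funext => y; rewrite (poissonB _ _ mphi phiB mNB normN) poisson_cst.
rewrite !avgB ?avg_cst; try exact: sup_bounded_cst; try exact: bp.
move=> H1 H2; apply/eqP; rewrite eq_le; apply/andP; split.
  rewrite -(lerD2r (- - B)); apply: H1 => w; have /andP[lo up] := absB w.
  by rewrite subr_ge0 lo opprK lerD2r.
rewrite -lerN2 -(lerD2l B); apply: H2 => [|w]; first exact: measurable_funB.
by have /andP[lo up] := absB w; rewrite subr_ge0 up lerD2l lerNl.
Qed.

End poisson_integral.

(** * The mean value property *)

(** Points of [X] are closed in [K] and the limit lies on the boundary. *)
Lemma boundary_limit_escape (R : realType) (X : pcountType) (d : measure_display)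
    (W : measurableType d) (Pr : X -> probability W R)
    (Z : nat -> {mfun W >-> discrete_space X}) (K : ptopologicalType)
    (i : X -> K) (Zoo : {mfun W >-> borel_space K}) :
  hausdorff_space K -> boundary_limit Pr i Z Zoo ->
  forall x y, {ae Pr x, forall w, exists N, forall n, (N <= n)%N -> Z n w <> y}.
Proof.
move=> hK [bZ cvZ] x y; apply: filterS (cvZ x) => w cvw.
have oU : open (~` [set i y]).
  by apply: closed_openC; apply: accessible_closed_set1; exact: hausdorff_accessible.
have ZU : (~` [set i y]) (Zoo w).
  by move=> e; apply: (bZ w); exists y.
have [N _ HN] := cvw _ (open_nbhs_nbhs (conj oU ZU)).
by exists N => n Nn e; apply: (HN n Nn); rewrite /= e.
Qed.

(** Negligible sets of [W] need not come from the boundary: going back from [Pr x]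
    to its image uses that the zero set of [l] is measurable. *)
Lemma ae_harmonic_measure (R : realType) (X : pcountType) (d : measure_display)
    (W : measurableType d) (Pr : X -> probability W R) (K : ptopologicalType)
    (i : X -> K) (Zoo : {mfun W >-> borel_space K}) (l : borel_space K -> R) (x : X) :
  (forall w, boundary i (Zoo w)) -> measurable_fun setT l ->
  {ae harmonic_measure Pr Zoo x, forall xi, boundary i xi -> l xi = 0} <->
  {ae Pr x, forall w, l (Zoo w) = 0}.
Proof.
move=> bZ ml; split => [[A [mA A0 sA]]|[B [mB B0 sB]]].
  exists (Zoo @^-1` A); split => //.
    by rewrite -[X in measurable X]setTI; exact: measurable_funPT.
  by move=> w /= nl; apply: sA => H; apply: nl; exact: H.
have m0 : measurable (l @^-1` [set 0]).
  by rewrite -[X in measurable X]setTI; exact: ml.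
have mZ : measurable (Zoo @^-1` (~` (l @^-1` [set 0]))).
  by rewrite -[X in measurable X]setTI; apply: measurable_funPT => //; exact: measurableC.
have sZ : Zoo @^-1` (~` (l @^-1` [set 0])) `<=` B by move=> w /= nl; exact: sB.
exists (~` (l @^-1` [set 0])); split; first exact: measurableC.
  exact: (subset_measure0 mZ mB sZ B0).
by move=> xi /= h l0; apply: h.
Qed.

Theorem theorem13 (R : realType) (X : pcountType) (p : X -> X -> R)
  (d : measure_display) (W : measurableType d) (Pr : X -> probability W R)
  (Z : nat -> {mfun W >-> discrete_space X})
  (K : ptopologicalType) (i : X -> K) (Zoo : {mfun W >-> borel_space K})
  (base : X) (mu : signed_measure X R) :
  let F := hitting Pr Z in
  let k := martin_kernel Pr Z in
  let khat := extended_kernel k i in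
  let kstar := fun (x : X) (y : discrete_space X) =>
    ereal_sup [set (k x y z)%:E | z in [set: X]] in
  stochastic p ->
  markov_chain p Pr Z ->
  irreducible Pr Z ->
  transient Pr Z ->
  martin_compactification k base i ->
  boundary_limit Pr i Z Zoo ->
  [/\ forall x y : X,
        [/\ ereal_sup [set (khat x y z)%:E | z in [set: K]] = (1 / F x y)%:E,
            exists z : X, k x y z = 1 / F x y
          & forall z : X, k x y z <= 1 / F x y],
      forall x y : X,
        (variation_measure mu).-integrable setT (kstar x) <->
        (variation_measure mu).-integrable setT (kstar y)
    & forall o : X,
        (variation_measure mu).-integrable setT (kstar o) ->
        let wmv := weak_mean_value p mu o in
        let martin_mv := ae_boundary Pr i Zoo (fun xi =>
          mean_value_defect mu (fun x => khat o x xi) o = 0) in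
        (martin_mv -> wmv) /\
        (almost_regular Pr i Zoo -> (wmv <-> martin_mv))].
Proof.
move=> F k khat kstar sto chain irr _ [[_ hK _ _ dense_i] base_ext _] blim.
have escape := boundary_limit_escape hK blim.
have [bZ limit] := blim.
have F0 x y : 0 < F x y := hitting_gt0 irr x y.
have kstarE x : kstar x = EFin \o (fun y => 1 / F x y).
  apply/funext => y; apply/eqP; rewrite eq_le; apply/andP; split.
    by apply: ge_ereal_sup => _ [z _ <-]; rewrite lee_fin (martin_kernel_le chain irr escape).
  by apply: ereal_sup_ubound; exists y => //; congr EFin; exact: (martin_kernel_diag chain).
have g1 x y : 1 <= 1 / F x y.
  by rewrite ler_pdivlMr// mul1r (hitting_le1 Pr Z).
have d0 x y : 0 <= 1 / F x y := le_trans ler01 (g1 x y).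
split => [x y|x y|o io].
- split.
  + exact: (ereal_sup_extended_kernel dense_i chain irr escape base_ext).
  + by exists y; exact: (martin_kernel_diag chain).
  + by move=> z; exact: (martin_kernel_le chain irr escape).
- suff H u v : (variation_measure mu).-integrable setT (kstar u) ->
      (variation_measure mu).-integrable setT (kstar v) by split; exact: H.
  rewrite !kstarE => iu.
  have := integrableZl measurableT (1 / F v u) iu.
  apply: le_integrable => //.
  move=> z _ /=; rewrite lee_fin (ger0_norm (d0 v z)) (ger0_norm (mulr_ge0 (d0 v u) (d0 u z))).
  rewrite !div1r -invfM lef_pV2 ?posrE ?mulr_gt0//.
  exact: (hitting_mul chain escape).
- move: io; rewrite kstarE => io wmv martin_mv.
  pose G (x : X) (xi : borel_space K) := khat o x xi.
  have Gg x xi : `|G x xi| <= 1 / F o x :=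
    extended_kernel_norm dense_i chain irr escape base_ext o x xi.
  have mG x : measurable_fun setT (G x).
    apply: measurable_continuous_borel.
    exact: (extended_kernel_continuous dense_i chain irr escape base_ext).
  have mGZ x : measurable_fun setT (fun w => G x (Zoo w)) by exact: measurable_Zoo.
  pose l (xi : borel_space K) := mean_value_defect mu (G ^~ xi) o.
  have ml : measurable_fun setT l := measurable_mean_value_defect (g1 o) io mG o.
  have aeP x := ae_harmonic_measure Pr x bZ ml.
  have wmvP : martin_mv -> wmv.
    move=> [z /aeP l0] h /(bounded_harmonicP chain sto) [[M hM] hh].
    have M0 : 0 <= M := le_trans (normr_ge0 _) (hM point).
    have [Psi [mPsi PsiM cvP]] :=
      boundary_approximation dense_i chain irr escape base_ext limit z hM hh.
    (* the kernels based at [z] are [k_z(x,.) = k_o(x,.) k_z(o,.)]: the change of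
       base point goes into the weights *)
    pose Phi n w := Psi n w * khat z o (Zoo w).
    have mPhi n : measurable_fun setT (Phi n).
      apply: measurable_funM => //.
      exact: (measurable_extended_kernel Zoo dense_i chain irr escape base_ext).
    have PhiM n w : `|Phi n w| <= M * (1 / F z o).
      by rewrite normrM ler_pM// (extended_kernel_norm dense_i chain irr escape base_ext).
    pose a n x := \int[Pr z]_w (Phi n w * G x (Zoo w)).
    have aE n x : a n x = \int[Pr z]_w (Psi n w * khat z x (Zoo w)).
      apply: eq_Rintegral => w _; rewrite /Phi -mulrA; congr (_ * _).
      by rewrite [RHS](extended_kernel_change dense_i chain irr escape base_ext o) mulrC.
    have iG n x : (Pr z).-integrable setT (EFin \o (fun w => Phi n w * G x (Zoo w))).
      apply: (@bounded_integrable _ _ _ _ _ (M * (1 / F z o) * (1 / F o x))).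
        exact: measurable_funM.
      by move=> w; rewrite normrM ler_pM.
    have cvd : mean_value_defect mu (a n) o @[n --> \oo] --> mean_value_defect mu h o.
      apply: (mean_value_defect_cvg io (C := M * (1 / F z o))) => [n x|x].
        rewrite (le_trans (le_normr_Rintegral _ (iG n x)))//.
        rewrite -[leRHS](prob_Rintegral_cst (Pr z)); apply: le_Rintegral => //.
        - exact: integrable_abse (iG n x).
        - exact: finite_measure_integrable_cst.
        - by move=> w _; rewrite normrM ler_pM.
      by under eq_fun do rewrite aE; exact: cvP.
    have a0 n : mean_value_defect mu (a n) o = 0.
      rewrite (mean_value_defect_integral (g1 o) io (Pr z) mGZ _ o (mPhi n) (PhiM n))//.
      rewrite -[RHS](prob_Rintegral_cst (Pr z)) /Rintegral; congr fine.
      apply: ae_eq_integral => //.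
      - apply/measurable_EFinP; apply: measurable_funM => //.
        exact: (measurable_Zoo Zoo ml).
      - apply: filterS l0 => w lw _; rewrite [X in (_ * X)%:E]lw mulr0//.
    rewrite -(cvg_lim _ cvd)//; apply/cvg_lim => //.
    by under eq_fun do rewrite a0; exact: cvg_cst.
  split => // _; split => // hw; exists o; apply/aeP.
  have [B lB] := mean_value_defect_bounded (g1 o) io Gg o.
  have mlZ : measurable_fun setT (fun w => l (Zoo w)) := measurable_Zoo Zoo ml.
  have lZB w : `|l (Zoo w)| <= B := lB (Zoo w).
  pose h := poisson_integral Pr Z i Zoo o (fun w => l (Zoo w)).
  have hb : bounded_harmonic p h.
    apply/(bounded_harmonicP chain sto); split.
      by exists B => x; exact: (poisson_le dense_i chain irr escape base_ext limit).
    by move=> x; exact: (poisson_harmonic dense_i chain irr escape base_ext limit _ _ mlZ lZB).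
  (* the defect of [h] is the mean of the square of [l] *)
  have := hw h hb.
  rewrite (mean_value_defect_integral (g1 o) io (Pr o) mGZ _ o mlZ lZB)// => l2.
  have il : (Pr o).-integrable setT (EFin \o (fun w => l (Zoo w) * l (Zoo w))).
    apply: (@bounded_integrable _ _ _ _ _ (B * B)); first exact: measurable_funM.
    by move=> w; rewrite normrM ler_pM.
  have l2E : (\int[Pr o]_w `|(l (Zoo w) * l (Zoo w))%:E| = 0)%E.
    rewrite (@eq_integral _ _ _ _ _ (fun w => (l (Zoo w) * l (Zoo w))%:E)).
      by rewrite -[LHS]fineK ?(integrable_fin_num _ il)// [fine _]l2.
    by move=> w _; rewrite gee0_abs// lee_fin -expr2 sqr_ge0.
  have /(ae_eq_integral_abs _ measurableT) : measurable_fun setT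
      (EFin \o (fun w => l (Zoo w) * l (Zoo w))) by exact: measurable_int il.
  move=> /(_ (Pr o)) [/(_ l2E) + _]; apply: filterS => w /(_ I) [] /eqP.
  by rewrite mulf_eq0 orbb => /eqP.
Qed.
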